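(* Let $V$ be a $C_2$-cofinite vertex operator algebra with two commuting automorphisms $g_1,g_2$ of finite order, and set $g_3=g_1g_2$. Let $W^1$ and $W^2$ be $C_1$-cofinite generalized $g_1$-twisted and $g_2$-twisted $V$-modules, respectively. Let $S^1,\dots,S^p$ be a complete set of representatives of the isomorphism classes of irreducible grading restricted generalized $g_3$-twisted $V$-modules, with conformal weights $u_1,\dots,u_p$, and for a grading restricted generalized $g_3$-twisted $V$-module $W$ put $d_W=\dim W_{(u_1)}+\cdots+\dim W_{(u_p)}$. Let $(W^1\odot W^2,\mathcal{Y}^{\odot})\in\mathcal{F}_{(W^1,W^2)}$ be such that $d_{W^1\odot W^2}$ is maximal among all $d_U$ with $(U,\mathcal{Y})\in\mathcal{F}_{(W^1,W^2)}$. Then the pair $(W^1\odot W^2,\mathcal{Y}^{\odot})$ is the fusion product of $W^1$ and $W^2$.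
   Context: Vertex operator algebras $(V,Y,\mathbf 1,\omega)$ are over $\mathbb{C}$, in the standard (Frenkel-Huang-Lepowsky) sense; $\mathbb{N}$ contains $0$. $V$ is $C_2$-cofinite if $V/\mathrm{span}\{u_{-2}v\mid u,v\in V\}$ is finite-dimensional. Twisted modules. Let $g$ be an automorphism of $V$ of finite order $T$, and let $V^{(g,r)}=\{v\in V\mid gv=e^{-2\pi \mathrm{i} r/T}v\}$, $0\le r\le T-1$. A weak $g$-twisted $V$-module (also called $g$-twisted $V$-module) is a vector space $W$ with a linear map $Y_W(-,x):V\to \mathrm{End}(W)[[x^{1/T},x^{-1/T}]]$, $v\mapsto Y_W(v,x)=\sum_{n\in\frac1T\mathbb{Z}}v_nx^{-n-1}$, such that: $Y_W(\mathbf 1,x)=\mathrm{id}_W$; $Y_W(u,x)w\in x^{r/T}W((x))$ for $u\in V^{(g,r)}$, $w\in W$; and for $v\in V^{(g,r)}$, $u\in V$, $$x_0^{-1}\delta\left(\tfrac{x_1-x_2}{x_0}\right)Y_W(v,x_1)Y_W(u,x_2)-x_0^{-1}\delta\left(\tfrac{x_2-x_1}{-x_0}\right)Y_W(u,x_2)Y_W(v,x_1)=x_1^{-1}\delta\left(\tfrac{x_2+x_0}{x_1}\right)\left(\tfrac{x_2+x_0}{x_1}\right)^{-r/T}Y_W(Y(v,x_0)u,x_2).$$ Write $Y_W(\omega,x)=\sum_n L(n)x^{-n-2}$ and $W_{(\lambda)}=\{w\in W\mid (L(0)-\lambda)^kw=0\text{ for some }k\in\mathbb{N}\}$. A generalized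 $g$-twisted $V$-module is a weak one with $W=\bigoplus_{\lambda\in\mathbb{C}}W_{(\lambda)}$ such that for each $\lambda\in\mathbb{C}$, $W_{(\lambda+n/T)}=0$ for all sufficiently negative integers $n$. It is grading restricted if moreover every $W_{(\lambda)}$ is finite-dimensional. $C_1$-cofiniteness. $C_1(W)$ is the span of all $v_{-1}w$ with $v\in V^{(g,0)}$ homogeneous, $\mathrm{wt}\,v>0$, $w\in W$, together with all $v_{-1-r/T}w$ with $v\in V^{(g,r)}$ homogeneous, $r=1,\dots,T-1$, $\mathrm{wt}\,v\ge 0$, $w\in W$. $W$ is $C_1$-cofinite if $\dim W/C_1(W)<\infty$. Twisted logarithmic intertwining operators. Let $T_k$ be the order of $g_k$ ($k=1,2,3$) and $V^{(r_1,r_2)}=\{v\mid g_kv=e^{-2\pi \mathrm{i} r_k/T_k}v,\ k=1,2\}$ for $0\le r_k<T_k$. For $g_k$-twisted modules $W^k$, a twisted logarithmic intertwining operator of type $\binom{W^3}{W^1\ W^2}$ is a linear map $\mathcal{Y}(-,x):W^1\otimes W^2\to W^3[\log x]\{x\}$, $\mathcal{Y}(w^1,x)w^2=\sum_{n\in\mathbb{C}}\sum_{k\in\mathbb{N}}(w^1)^{\mathcal{Y}}_{n;k}w^2\,x^{-n-1}(\log x)^k$ ($\{x\}$ denotes formal series in arbitrary complex powers of $x$) such that: (i) for all $w^1,w^2$ and $h\in\mathbb{C}$, $(w^1)^{\mathcal{Y}}_{h+n;k}w^2=0$ for $n\in\mathbb{N}$ sufficiently large, independently of $k$; (ii) for $v\in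 V^{(r_1,r_2)}$, $$x_0^{-1}\delta\left(\tfrac{x_1-x_2}{x_0}\right)\left(\tfrac{x_1-x_2}{x_0}\right)^{-r_1/T_1}Y_{W^3}(v,x_1)\mathcal{Y}(w^1,x_2)w^2-x_0^{-1}\delta\left(\tfrac{-x_2+x_1}{x_0}\right)\left(\tfrac{-x_2+x_1}{x_0}\right)^{-r_1/T_1}\mathcal{Y}(w^1,x_2)Y_{W^2}(v,x_1)w^2$$ $$=x_1^{-1}\delta\left(\tfrac{x_2+x_0}{x_1}\right)\left(\tfrac{x_2+x_0}{x_1}\right)^{-r_2/T_2}\mathcal{Y}(Y_{W^1}(v,x_0)w^1,x_2)w^2,$$ where $(-x)^\alpha$ means $e^{\pi \mathrm{i}\alpha}x^\alpha$; (iii) $\mathcal{Y}(L(-1)w^1,x)=\frac{d}{dx}\mathcal{Y}(w^1,x)$. $\mathcal{I}\binom{W^3}{W^1\ W^2}$ denotes the space of these operators. $\mathrm{Im}\,\mathcal{Y}$ is the span of all coefficients $(w^1)^{\mathcal{Y}}_{n;k}w^2$, and $\mathcal{Y}$ is surjective if $\mathrm{Im}\,\mathcal{Y}=W^3$. $\mathcal{F}_{(W^1,W^2)}$ is the set of pairs $(U,\mathcal{Y})$ with $U$ a generalized $g_3$-twisted $V$-module and $\mathcal{Y}\in\mathcal{I}\binom{U}{W^1\ W^2}$ surjective, modulo: $(U,\mathcal{Y}_1)\cong(W,\mathcal{Y}_2)$ if there is an isomorphism $f:U\to W$ of $g_3$-twisted $V$-modules with $f\circ\mathcal{Y}_1=\mathcal{Y}_2$.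 For every $(U,\mathcal{Y})\in\mathcal{F}_{(W^1,W^2)}$ the module $U$ is automatically grading restricted, and the numbers $d_U$ are uniformly bounded, so a maximal one exists. The conformal weight of $S^i$ is the number $u_i\in\mathbb{C}$ with $S^i=\bigoplus_{n\in\mathbb{N}}S^i_{(u_i+n/T_3)}$ and $S^i_{(u_i)}\neq0$. Fusion product. A fusion product of $W^1$ and $W^2$ is a pair $(W^1\boxtimes W^2,\mathcal{Y}^{\boxtimes})$ with $W^1\boxtimes W^2$ a generalized $g_3$-twisted $V$-module and $\mathcal{Y}^{\boxtimes}\in\mathcal{I}\binom{W^1\boxtimes W^2}{W^1\ W^2}$ such that for every generalized $g_3$-twisted $V$-module $W$ and every $\mathcal{Y}\in\mathcal{I}\binom{W}{W^1\ W^2}$ there is a unique $g_3$-twisted $V$-module homomorphism $\phi:W^1\boxtimes W^2\to W$ with $\mathcal{Y}=\phi\circ\mathcal{Y}^{\boxtimes}$. *)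

(* Defs.v *)
From mathcomp Require Import all_boot all_order all_algebra.
From mathcomp Require Import all_classical.
From mathcomp Require Import reals trigo.
From mathcomp.real_closed Require Import complex.

Set Implicit Arguments.
Unset Strict Implicit.
Unset Printing Implicit Defensive.

Import Order.TTheory GRing.Theory Num.Theory.

Local Open Scope classical_set_scope.
Local Open Scope ring_scope.
Local Open Scope complex_scope.

Section Scalars.
Variable R : realType.

(* exp (i t) for real t *)
Definition cis (t : R) : R[i] := cos t +i* sin t.

(* the coefficient of x^(s-i) y^i in (x + y)^s, for complex s *)
Definition cbinom (s : R[i]) (i : nat) : R[i] :=
  (\prod_(j < i) (s - j%:R)) / i`!%:R.

Definition root_frac (r T : nat) : R := r%:R / T%:R.

End Scalars.

Section LinearAlgebra.
Variables (K : fieldType) (M : lmodType K).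
Implicit Types (S A : set M).

Definition subspace S : Prop :=
  S 0 /\ forall (a : K) (x y : M), S x -> S y -> S (a *: x + y).

Definition span A : set M := smallest subspace A.

Definition has_dim S (n : nat) : Prop :=
  exists b : 'I_n -> M, (forall i, S (b i)) /\
    forall x, S x -> exists! c : 'rV[K]_n, x = \sum_(i < n) c 0 i *: b i.

Definition fin_dim S : Prop := exists n, has_dim S n.

(* Takes the value 0 when S is infinite-dimensional. *)
Definition vs_dim S : nat := xget 0%N (has_dim S).

(* M / S is finite-dimensional, i.e. spanned by finitely many classes. *)
Definition fin_codim S : Prop :=
  exists (n : nat) (b : 'I_n -> M), forall x, exists c : 'rV[K]_n,
    S (x - \sum_(i < n) c 0 i *: b i).

Definition direct_sum (I : eqType) (G : I -> set M) : Prop :=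
  [/\ forall i, subspace (G i),
      span (\bigcup_i G i) = [set: M]
    & forall (s : seq I) (f : I -> M), uniq s ->
        (forall i, i \in s -> G i (f i)) -> \sum_(i <- s) f i = 0 ->
        forall i, i \in s -> f i = 0].

End LinearAlgebra.

(* Infinite sums below are finitely supported sums over nat: finiteness of the
   support always follows from the truncation axioms of the structure. *)

(* [voa_mode v n] is v_n, where Y(v, x) = \sum_n v_n x^(-n-1). The Jacobi
   identity
     x0^-1 delta((x1-x2)/x0) Y(u,x1) Y(v,x2)
       - x0^-1 delta((x2-x1)/(-x0)) Y(v,x2) Y(u,x1)
       = x2^-1 delta((x1-x0)/x2) Y(Y(u,x0)v,x2)
   is stated by equating coefficients of x0^(-l-1) x1^(-p-1) x2^(-q-1), after
   rewriting x2^-1 delta((x1-x0)/x2) as x1^-1 delta((x2+x0)/x1). *)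
Record voa (R : realType) := VOA {
  voa_car :> lmodType R[i];
  voa_grade : int -> set voa_car;
  voa_mode : voa_car -> int -> voa_car -> voa_car;
  voa_vac : voa_car;
  voa_omega : voa_car;
  voa_charge : R[i];
  voa_direct_sum : direct_sum voa_grade;
  voa_fin_dim : forall n, fin_dim (voa_grade n);
  voa_lower_bounded :
    exists N : int, forall n, n < N -> voa_grade n `<=` [set 0];
  voa_mode_linearl : forall n v, linear (fun u => voa_mode u n v);
  voa_mode_linearr : forall u n, linear (voa_mode u n);
  voa_truncation :
    forall u v, exists N : int, forall n, N <= n -> voa_mode u n v = 0;
  voa_vac_grade : voa_grade 0 voa_vac;
  voa_omega_grade : voa_grade 2 voa_omega;
  voa_vacuum :
    forall n v, voa_mode voa_vac n v = if n == -1 then v else 0;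
  voa_creation : forall v,
    voa_mode v (-1) voa_vac = v /\
    forall n, 0 <= n -> voa_mode v n voa_vac = 0;
  voa_jacobi : forall (u v w : voa_car) (l p q : int),
    \sum_(i \in [set: nat]) ((-1) ^+ i * cbinom l%:~R i) *:
        voa_mode u (p + l - i%:Z) (voa_mode v (q + i%:Z) w)
    - \sum_(i \in [set: nat]) ((-1) ^ l * (-1) ^+ i * cbinom l%:~R i) *:
        voa_mode v (q + l - i%:Z) (voa_mode u (p + i%:Z) w)
    = \sum_(i \in [set: nat]) cbinom p%:~R i *:
        voa_mode (voa_mode u (l + i%:Z) v) (p + q - i%:Z) w;
  voa_virasoro : forall (m n : int) v,
    voa_mode voa_omega (m + 1) (voa_mode voa_omega (n + 1) v)
    - voa_mode voa_omega (n + 1) (voa_mode voa_omega (m + 1) v)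
    = (m - n)%:~R *: voa_mode voa_omega (m + n + 1) v
      + (if m + n == 0 then (m ^+ 3 - m)%:~R / 12%:R * voa_charge else 0) *: v;
  voa_L0 : forall n v, voa_grade n v -> voa_mode voa_omega 1 v = n%:~R *: v;
  voa_Lm1 : forall u n v,
    voa_mode (voa_mode voa_omega 0 u) n v = - n%:~R *: voa_mode u (n - 1) v
}.

Definition C2_cofinite (R : realType) (V : voa R) : Prop :=
  fin_codim (span [set x : V | exists u v : V, x = voa_mode u (- 2%:Z) v]).

Record fin_aut (R : realType) (V : voa R) := FinAut {
  aut_fun :> V -> V;
  aut_order : nat;
  aut_linear : linear aut_fun;
  aut_bij : bijective aut_fun;
  aut_mode : forall (u : V) n (v : V),
    aut_fun (voa_mode u n v) = voa_mode (aut_fun u) n (aut_fun v);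
  aut_vac : aut_fun (voa_vac V) = voa_vac V;
  aut_omega : aut_fun (voa_omega V) = voa_omega V;
  aut_order_gt0 : (0 < aut_order)%N;
  aut_orderP : forall v, iter aut_order aut_fun v = v;
  aut_order_min : forall n, (0 < n < aut_order)%N ->
    ~ (forall v, iter n aut_fun v = v)
}.

(* V^(g,r) *)
Definition aut_eig (R : realType) (V : voa R) (g : fin_aut V) (r : nat)
  : set V := [set v | g v = cis (- (2 * pi * root_frac R r (aut_order g))) *: v].

(* Modes of a g-twisted module are indexed by complex numbers and vanish outside
   (1/T)Z. The twisted Jacobi identity is stated by equating coefficients of
   x0^(-l-1) x1^(-p-1) x2^(-q-1); both sides vanish identically unless
   p is in -r/T + Z, since Y(v,x)w is in x^(r/T) W((x)). *)
Record twisted_module (R : realType) (V : voa R) (g : fin_aut V) :=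
  TwistedModule {
  tw_car :> lmodType R[i];
  tw_mode : V -> R[i] -> tw_car -> tw_car;
  tw_mode_linearl : forall n w, linear (fun v => tw_mode v n w);
  tw_mode_linearr : forall v n, linear (tw_mode v n);
  tw_support : forall v (n : R[i]) w,
    (forall k : int, n != k%:~R / (aut_order g)%:R) -> tw_mode v n w = 0;
  tw_vacuum :
    forall n w, tw_mode (voa_vac V) n w = if n == -1 then w else 0;
  tw_grading : forall (r : nat) v (n : R[i]) w,
    (r < aut_order g)%N -> aut_eig g r v ->
    (forall k : int, n != k%:~R - (root_frac R r (aut_order g))%:C) ->
    tw_mode v n w = 0;
  tw_truncation : forall (r : nat) v w,
    (r < aut_order g)%N -> aut_eig g r v ->
    exists N : int, forall k : int, N <= k ->
      tw_mode v (k%:~R - (root_frac R r (aut_order g))%:C) w = 0;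
  tw_jacobi : forall (r : nat) (v u : V) (w : tw_car) (l m : int) (q : R[i]),
    (r < aut_order g)%N -> aut_eig g r v ->
    let p : R[i] := m%:~R - (root_frac R r (aut_order g))%:C in
    \sum_(i \in [set: nat]) ((-1) ^+ i * cbinom l%:~R i) *:
        tw_mode v (p + l%:~R - i%:R) (tw_mode u (q + i%:R) w)
    - \sum_(i \in [set: nat]) ((-1) ^ l * (-1) ^+ i * cbinom l%:~R i) *:
        tw_mode u (q + l%:~R - i%:R) (tw_mode v (p + i%:R) w)
    = \sum_(i \in [set: nat]) cbinom p i *:
        tw_mode (voa_mode v (l + i%:Z) u) (p + q - i%:R) w
}.

Section Modules.
Variables (R : realType) (V : voa R) (g : fin_aut V).
Implicit Types W U : twisted_module g.

Definition tw_L W (n : int) : W -> W :=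
  tw_mode (voa_omega V) (n%:~R + 1).

(* W_(lambda) *)
Definition gen_eig W (lambda : R[i]) : set W :=
  [set w | exists k : nat,
     iter k (fun x : W => tw_L 0 x - lambda *: x) w = 0].

Definition generalized W : Prop :=
  direct_sum (@gen_eig W) /\
  forall lambda : R[i], exists N : int, forall n : int, n < N ->
    @gen_eig W (lambda + n%:~R / (aut_order g)%:R) `<=` [set 0].

Definition grading_restricted W : Prop :=
  generalized W /\ forall lambda, fin_dim (@gen_eig W lambda).

Definition C1 W : set W :=
  span [set x | exists (r : nat) (n : int) (v : V) (w : W),
    [/\ (r < aut_order g)%N, aut_eig g r v, voa_grade n v,
        (if r == 0%N then 0 < n else 0 <= n)
      & x = tw_mode v (- 1 - (root_frac R r (aut_order g))%:C) w]].

Definition C1_cofinite W : Prop := fin_codim (@C1 W).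

Definition tw_submodule W (S : set W) : Prop :=
  subspace S /\ forall v n w, S w -> S (tw_mode v n w).

Definition irreducible W : Prop :=
  (exists w : W, w != 0) /\
  forall S : set W, tw_submodule S -> S = [set 0] \/ S = [set: W].

Definition tw_hom W U (f : W -> U) : Prop :=
  linear f /\ forall v n w, f (tw_mode v n w) = tw_mode v n (f w).

Definition tw_iso W U : Prop := exists2 f : W -> U, tw_hom f & bijective f.

Definition conformal_weight W (u : R[i]) : Prop :=
  direct_sum (fun n : nat => @gen_eig W (u + n%:R / (aut_order g)%:R)) /\
  exists2 w : W, gen_eig u w & w != 0.

Definition complete_irreducibles (p : nat) (S : 'I_p -> twisted_module g)
  : Prop :=
  [/\ forall i, irreducible (S i) /\ grading_restricted (S i),
      forall i j, tw_iso (S i) (S j) -> i = j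
    & forall W, irreducible W -> grading_restricted W ->
        exists i, tw_iso (S i) W].

Definition dim_at (p : nat) (u : 'I_p -> R[i]) W : nat :=
  (\sum_(i < p) vs_dim (@gen_eig W (u i)))%N.

End Modules.

Section Intertwining.
Variables (R : realType) (V : voa R) (g1 g2 g3 : fin_aut V).
Variables (W1 : twisted_module g1) (W2 : twisted_module g2).

(* [Y w1 n k w2] is the coefficient of x^(-n-1) (log x)^k in Y(w1, x)w2.
   The Jacobi identity is stated by equating coefficients of
   x0^(-s-1) x1^(-p-1) x2^(-q-1) (log x2)^k, both sides vanishing identically
   unless s is in -r1/T1 + Z and p is in -r2/T2 + Z. The expansions used are
     x0^-1 delta(z/x0) (z/x0)^a = \sum_(s in a + Z) z^s x0^(-s-1),
     (x1 - x2)^s = \sum_i (-1)^i binom(s,i) x1^(s-i) x2^i,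
     (-x2 + x1)^s = \sum_i binom(s,i) exp(pi i (s-i)) x2^(s-i) x1^i,
     (x2 + x0)^p = \sum_i binom(p,i) x2^(p-i) x0^i. *)
Record intertwining (W3 : twisted_module g3)
    (Y : W1 -> R[i] -> nat -> W2 -> W3) : Prop := Intertwining {
  io_linearl : forall n k w2, linear (fun w1 => Y w1 n k w2);
  io_linearr : forall w1 n k, linear (Y w1 n k);
  io_log : forall w1 n w2, exists K : nat,
    forall k, (K <= k)%N -> Y w1 n k w2 = 0;
  io_truncation : forall w1 w2 (h : R[i]), exists N : nat,
    forall n k, (N <= n)%N -> Y w1 (h + n%:R) k w2 = 0;
  io_jacobi : forall (r1 r2 : nat) (v : V) (w1 : W1) (w2 : W2)
      (l m : int) (q : R[i]) (k : nat),
    (r1 < aut_order g1)%N -> (r2 < aut_order g2)%N ->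
    aut_eig g1 r1 v -> aut_eig g2 r2 v ->
    let s : R := l%:~R - root_frac R r1 (aut_order g1) in
    let p : R[i] := m%:~R - (root_frac R r2 (aut_order g2))%:C in
    \sum_(i \in [set: nat]) ((-1) ^+ i * cbinom s%:C i) *:
        tw_mode v (p + s%:C - i%:R) (Y w1 (q + i%:R) k w2)
    - \sum_(i \in [set: nat]) (cis (pi * (s - i%:R)) * cbinom s%:C i) *:
        Y w1 (q + s%:C - i%:R) k (tw_mode v (p + i%:R) w2)
    = \sum_(i \in [set: nat]) cbinom p i *:
        Y (tw_mode v (s%:C + i%:R) w1) (p + q - i%:R) k w2;
  io_Lm1 : forall w1 n k w2,
    Y (tw_L (-1) w1) n k w2 =
      - n *: Y w1 (n - 1) k w2 + k.+1%:R *: Y w1 (n - 1) k.+1 w2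
}.

Definition surjective_io (W3 : twisted_module g3)
    (Y : W1 -> R[i] -> nat -> W2 -> W3) : Prop :=
  span [set x : W3 | exists w1 n k w2, x = Y w1 n k w2] = [set: W3].

(* (U, Y) represents a class of the set F_(W1,W2). *)
Definition in_F (U : twisted_module g3)
    (Y : W1 -> R[i] -> nat -> W2 -> U) : Prop :=
  [/\ generalized U, intertwining Y & surjective_io Y].

Definition fusion_product (P : twisted_module g3)
    (YP : W1 -> R[i] -> nat -> W2 -> P) : Prop :=
  [/\ generalized P, intertwining YP
    & forall (W : twisted_module g3) (Y : W1 -> R[i] -> nat -> W2 -> W),
        generalized W -> intertwining Y ->
        exists! phi : P -> W, tw_hom phi /\
          forall w1 n k w2, Y w1 n k w2 = phi (YP w1 n k w2)].

End Intertwining.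

(* Main.v *)
(* Given another pair (W, Y), let U be the image of (YP, Y) in P + W; it belongs
   to F_(W1,W2), and the first projection U -> P is onto. If U is grading
   restricted, maximality of d_P forces d of the kernel to vanish; a nonzero
   grading restricted module has an irreducible subquotient, hence a nonzero
   weight space at some u_i, so the kernel is zero. Inverting the projection and
   composing with the second one gives the homomorphism P -> W.

   That U is grading restricted is where C_1-cofiniteness enters. Modulo C_1(U),
   the Jacobi identity moves the factors v_(-1-r/T) out of either argument of Y
   and lowers the total weight, so U / C_1(U) is spanned by the coefficients of
   Y(e,x)f with e and f in finite sets of homogeneous representatives of
   W1 / C_1(W1) and W2 / C_1(W2). Each weight space contains finitely many of
   these, and C_1(U) adds only contributions of lower weight spaces. *)
Require Import Defs.
From HB Require Import structures.
From mathcomp Require Import all_boot all_order all_algebra.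
From mathcomp Require Import all_classical.
From mathcomp Require Import reals trigo.
From mathcomp.real_closed Require Import complex.
From mathcomp Require Import zify ring lra.
Import Defs.

Set Implicit Arguments.
Unset Strict Implicit.
Unset Printing Implicit Defensive.

Import Order.TTheory GRing.Theory Num.Theory.

Local Open Scope classical_set_scope.
Local Open Scope ring_scope.
Local Open Scope complex_scope.

(** * Linear algebra *)

(** The Jacobi identity of [Y] speaks of joint eigenvectors of [g1] and [g2], while [C1] of one
    argument only provides eigenvectors of one automorphism; since [g1] and [g2] commute, such a
    vector splits into joint eigenvectors of the same weight. For a nonzero joint eigenvector,
    $r_1/T_1+r_2/T_2=r_3/T_3+e$ with a carry $e\in\{0,1\}$. The carry and the tails of the
    expansions produce modes of [v] on [U] below $-1-r_3/T_3$; by $(L(-1)v)_n=-n\,v_{n-1}$ these are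
    multiples of modes $-1-r_3/T_3$ of vectors of larger weight, so they still land in [C1]. A
    factor that passes from one argument to the other carries its weight along, yet the total weight
    drops, because the exponents $r_1/T_1$ and $r_2/T_2$ differ by less than 1. The two weights lie
    in cosets of different lattices, so the induction runs on an integer, the total weight above the
    lower bounds multiplied by $T_1T_2$. Weight spaces are identified indirectly throughout:
    subspaces of them that together span the module must fill them. *)

Section LinearMaps.
Variables (K : fieldType) (M N : lmodType K) (f : M -> N).
Hypothesis lf : linear f.

Lemma lin0 : f 0 = 0.
Proof.
have := lf (-1) 0 0; rewrite scaler0 addr0 scaleN1r => h.
by rewrite {1}h addNr.
Qed.

Lemma linD x y : f (x + y) = f x + f y.
Proof. by rewrite -[x]scale1r lf !scale1r. Qed.

Lemma linZ a x : f (a *: x) = a *: f x.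
Proof. by have := lf a x 0; rewrite lin0 !addr0. Qed.

Lemma linN x : f (- x) = - f x.
Proof. by rewrite -scaleN1r linZ scaleN1r. Qed.

Lemma linB x y : f (x - y) = f x - f y.
Proof. by rewrite linD linN. Qed.

Lemma lin_sum (I : Type) (r : seq I) (P : pred I) (F : I -> M) :
  f (\sum_(i <- r | P i) F i) = \sum_(i <- r | P i) f (F i).
Proof.
elim/big_rec2: _ => [|i y x _ <-]; first exact: lin0.
exact: linD.
Qed.

Lemma inj_lin : (forall x, f x = 0 -> x = 0) -> injective f.
Proof.
by move=> f0 x y fxy; apply/eqP; rewrite -subr_eq0; apply/eqP/f0;
   rewrite linB fxy subrr.
Qed.

End LinearMaps.

Section Subspaces.
Variables (K : fieldType) (M : lmodType K).
Implicit Types S A B : set M.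

Section Closure.
Variables (S : set M) (sS : subspace S).

Lemma subspace0 : S 0. Proof. by case: sS. Qed.

Lemma subspaceD x y : S x -> S y -> S (x + y).
Proof. by move=> Sx Sy; rewrite -[x]scale1r; apply: (proj2 sS). Qed.

Lemma subspaceZ a x : S x -> S (a *: x).
Proof. by move=> Sx; rewrite -[_ *: _]addr0; apply: (proj2 sS) => //; case: sS. Qed.

Lemma subspaceN x : S x -> S (- x).
Proof. by rewrite -scaleN1r; apply: subspaceZ. Qed.

Lemma subspaceB x y : S x -> S y -> S (x - y).
Proof. by move=> Sx Sy; apply: subspaceD => //; apply: subspaceN. Qed.

Lemma subspace_sum (I : eqType) (r : seq I) (P : pred I) (F : I -> M) :
  (forall i, i \in r -> P i -> S (F i)) -> S (\sum_(i <- r | P i) F i).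
Proof.
move=> SF; rewrite big_seq_cond; elim/big_ind: _ => //.
- exact: subspace0.
- exact: subspaceD.
- by move=> i /andP[]; apply: SF.
Qed.

Lemma subspace_addr x y : S x -> S (x + y) -> S y.
Proof. by move=> Sx Sxy; rewrite -[y](addKr x); apply: subspaceD => //; exact: subspaceN. Qed.

End Closure.

Lemma span_subspace A : subspace (span A).
Proof.
split=> [B [[]]//|a x y Ax Ay B BA]; have [[_ sB] _] := BA.
by apply: sB; [apply: Ax|apply: Ay].
Qed.

Lemma sub_span A : A `<=` span A. Proof. exact: sub_gen_smallest. Qed.

Lemma span_sub A B : subspace B -> A `<=` B -> span A `<=` B.
Proof. exact: smallest_sub. Qed.

Lemma span_mono A B : A `<=` B -> span A `<=` span B.
Proof. by move=> AB; apply: span_sub (span_subspace _) _ => x /AB; apply: sub_span. Qed.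

Lemma subspace_null : subspace ([set 0] : set M).
Proof. by split=> // a x y -> ->; rewrite scaler0 addr0. Qed.

Lemma subspace_setI A B : subspace A -> subspace B -> subspace (A `&` B).
Proof.
move=> sA sB; split; first by split; apply: subspace0.
by move=> a x y [Ax Bx] [Ay By]; split; [apply: (proj2 sA)|apply: (proj2 sB)].
Qed.

End Subspaces.

Lemma subspace_preim (K : fieldType) (M N : lmodType K) (f : M -> N) (S : set N) :
  linear f -> subspace S -> subspace (f @^-1` S).
Proof.
move=> lf sS; split=> [|a x y Sx Sy] /=; first by rewrite lin0 //; exact: subspace0.
by rewrite lf; apply: (proj2 sS).
Qed.

Lemma subspace_im (K : fieldType) (M N : lmodType K) (f : M -> N) (S : set M) :
  linear f -> subspace S -> subspace (f @` S).
Proof.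
move=> lf sS; split; first by exists 0; [exact: subspace0|exact: lin0].
by move=> a _ _ [x Sx <-] [y Sy <-]; exists (a *: x + y); [apply: (proj2 sS)|rewrite lf].
Qed.

Section FiniteDimension.
Variables (K : fieldType).

(** Neither are the generators required to lie in [A] or to be independent, nor is [A] required to
    be a subspace. The notion therefore passes freely to subsets, images, finite unions and bilinear
    images; [finspan_fin_dim] converts it to [fin_dim] for subspaces. *)
Definition finspan (M : lmodType K) (A : set M) :=
  exists s : seq M, A `<=` span [set x | x \in s].

Lemma finspan_sub (M : lmodType K) (A B : set M) :
  A `<=` B -> finspan B -> finspan A.
Proof. by move=> AB [s Bs]; exists s => x /AB /Bs. Qed.

Lemma finspan_span (M : lmodType K) (A : set M) : finspan A -> finspan (span A).
Proof. by move=> [s As]; exists s; apply: span_sub => //; apply: span_subspace. Qed.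

Lemma finspan_bigcup (M : lmodType K) (I : eqType) (r : seq I) (F : I -> set M) :
  (forall i, i \in r -> finspan (F i)) ->
  finspan (\bigcup_(i in [set` r]) F i).
Proof.
elim: r => [|j r IH] fF; first by exists [::] => x [].
have [s hs] : finspan (F j) by apply: fF; rewrite inE eqxx.
have [|t ht] := IH; first by move=> i ir; apply: fF; rewrite inE ir orbT.
exists (s ++ t) => x [i /=]; rewrite inE => /orP[/eqP ->|ir] Fx.
- by apply: (span_mono _ (hs _ Fx)) => y /= ys; rewrite mem_cat ys.
- apply: (span_mono _ (ht x _)); last by exists i.
  by move=> y /= yt; rewrite mem_cat yt orbT.
Qed.

Lemma finspan_setU (M : lmodType K) (A B : set M) :
  finspan A -> finspan B -> finspan (A `|` B).
Proof.
move=> [s As] [t Bt]; exists (s ++ t) => x [/As|/Bt]; apply: span_mono => y /=;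
  by rewrite mem_cat => ->; rewrite ?orbT.
Qed.

Lemma finspan_null (M : lmodType K) : finspan ([set 0] : set M).
Proof. by exists [::] => _ ->; exact: subspace0 (span_subspace _). Qed.

Lemma span_im (M N : lmodType K) (f : M -> N) (A : set M) :
  linear f -> f @` (span A) `<=` span (f @` A).
Proof.
move=> lf _ [x Ax <-]; pose B := f @^-1` span (f @` A).
apply: (span_sub (B := B)) Ax; first exact: subspace_preim (span_subspace _).
by move=> y Ay; apply: sub_span; exists y.
Qed.

Lemma finspan_im (M N : lmodType K) (f : M -> N) (A : set M) :
  linear f -> finspan A -> finspan (f @` A).
Proof.
move=> lf [s As]; exists (map f s) => _ [x /As xs <-].
apply: (span_mono (A := f @` [set x | x \in s])); last by apply: span_im => //; exists x.
by move=> _ [y /= ys <-]; apply: map_f.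
Qed.

Lemma finspan_bilin (M N P : lmodType K) (f : M -> N -> P) (A : set M) (B : set N) :
  (forall y, linear (f^~ y)) -> (forall x, linear (f x)) ->
  finspan A -> finspan B ->
  finspan [set z | exists x y, [/\ A x, B y & z = f x y]].
Proof.
move=> fl fr [s As] [t Bt]; exists [seq f x y | x <- s, y <- t].
move=> _ [x [y [/As xs /Bt yt ->]]].
pose S := span [set z | z \in [seq f x y | x <- s, y <- t]].
have sS : subspace S by exact: span_subspace.
apply: (span_sub (B := (f^~ y) @^-1` S)) xs; first exact: subspace_preim.
move=> x' /= x's; apply: (span_sub (B := (f x') @^-1` S)) yt; first exact: subspace_preim.
by move=> y' /= y't; apply: sub_span => /=; apply: allpairs_f.
Qed.

Variable M : lmodType K.

Definition lincomb n (b : 'I_n -> M) (c : 'rV[K]_n) : M := \sum_(i < n) c 0 i *: b i.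

Definition indep n (b : 'I_n -> M) := forall c, lincomb b c = 0 -> c = 0.

Lemma lincomb_linear n (b : 'I_n -> M) : linear (lincomb b).
Proof.
move=> a c d; rewrite /lincomb scaler_sumr -big_split; apply: eq_bigr => i _.
by rewrite !mxE scalerDl scalerA.
Qed.

Lemma lincomb_delta n (b : 'I_n -> M) i : lincomb b (delta_mx 0 i) = b i.
Proof.
rewrite /lincomb (bigD1 i) //= big1 => [|j ji]; rewrite mxE eqxx ?eqxx ?scale1r ?addr0 //.
by rewrite (negbTE ji) scale0r.
Qed.

Lemma has_dimP (S : set M) n : subspace S ->
  has_dim S n <-> exists b : 'I_n -> M,
    [/\ forall i, S (b i), indep b & forall x, S x -> exists c, x = lincomb b c].
Proof.
move=> sS; split=> [[b [Sb bP]]|[b [Sb ib bP]]]; exists b; split=> //.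
- move=> c c0; have [d [_ du]] := bP 0 (subspace0 sS).
  rewrite -(du c (esym c0)); apply: du.
  exact: esym (lin0 (lincomb_linear b)).
- by move=> x /bP[c [-> _]]; exists c.
- move=> x /bP[c xc]; exists c; split=> // d xd; apply/eqP; rewrite -subr_eq0.
  by apply/eqP/ib; rewrite (linB (lincomb_linear b)) -xc -[lincomb b d]xd subrr.
Qed.

Lemma lincomb_mul n m (b : 'I_n -> M) (d : 'I_m -> M) (A : 'M[K]_(m, n)) c :
  (forall i, d i = lincomb b (row i A)) -> lincomb d c = lincomb b (c *m A).
Proof.
move=> dA; rewrite {1}/lincomb mulmx_sum_row (lin_sum (lincomb_linear b)).
by apply: eq_bigr => i _; rewrite (linZ (lincomb_linear b)) -dA.
Qed.

Lemma indep_row_free n m (b : 'I_n -> M) (d : 'I_m -> M) (A : 'M[K]_(m, n)) :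
  (forall i, d i = lincomb b (row i A)) -> indep d -> row_free A.
Proof.
move=> dA id; rewrite -kermx_eq0; apply/eqP/row_matrixP => i; rewrite row0.
apply: id; rewrite (lincomb_mul _ dA) -row_mul mulmx_ker row0.
exact: lin0 (lincomb_linear b).
Qed.

Lemma lincomb_matrix n m (b : 'I_n -> M) (d : 'I_m -> M) :
  (forall i, exists c, d i = lincomb b c) ->
  exists A : 'M[K]_(m, n), forall i, d i = lincomb b (row i A).
Proof.
move=> db; exists (\matrix_i xget 0 [set c | d i = lincomb b c]) => i.
by rewrite rowK; case: xgetP => [c _ //|]; have [c dc] := db i => /(_ c).
Qed.

Lemma indep_leq n m (b : 'I_n -> M) (d : 'I_m -> M) :
  (forall i, exists c, d i = lincomb b c) -> indep d -> (m <= n)%N.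
Proof.
move=> /lincomb_matrix[A dA] /(indep_row_free dA); rewrite /row_free => /eqP <-.
exact: rank_leq_col.
Qed.

Lemma span_seqP (s : seq M) x : span [set y | y \in s] x ->
  exists c, x = lincomb (fun i : 'I_(size s) => s`_i) c.
Proof.
pose b := fun i : 'I_(size s) => s`_i; move=> xs.
have sB : subspace [set x | exists c, x = lincomb b c].
  split; first by exists 0; rewrite (lin0 (lincomb_linear b)).
  by move=> a _ _ [c ->] [d ->]; exists (a *: c + d); rewrite (lincomb_linear b).
apply: (span_sub sB) xs => y /= ys.
have iy : (index y s < size s)%N by rewrite index_mem.
by exists (delta_mx 0 (Ordinal iy)); rewrite lincomb_delta /b /= nth_index.
Qed.

(** Independent families in [S] have at most as many members as the generating list, so one of
    maximal size exists. A vector of [S] outside its span could be adjoined to it. *)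
Lemma finspan_fin_dim (S : set M) : subspace S -> finspan S -> fin_dim S.
Proof.
move=> sS [s Ss].
pose Q m := `[< exists d : 'I_m -> M, (forall i, S (d i)) /\ indep d >].
have Q0 : exists m, Q m.
  exists 0%N; apply/asboolP; exists (fun _ => 0); split=> [[]//|c _].
  by apply/rowP => -[].
have Qs m : Q m -> (m <= size s)%N.
  by move=> /asboolP[d [Sd id]]; apply: indep_leq id => i; apply: span_seqP; apply: Ss.
case: (ex_maxnP Q0 Qs) => m /asboolP[d [Sd id]] maxm.
exists m; apply/(has_dimP _ sS); exists d; split=> // x Sx.
apply: contrapT => nx; suff /maxm : Q m.+1 by rewrite ltnn.
pose d' (i : 'I_m.+1) := if unlift ord0 i is Some j then d j else x.
apply/asboolP; exists d'; split.
  by move=> i; rewrite /d'; case: unliftP.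
move=> c; rewrite /lincomb big_ord_recl /d' unlift_none.
under eq_bigr do rewrite liftK.
pose c' : 'rV_m := \row_j c 0 (lift ord0 j).
have -> : \sum_(i < m) c 0 (lift ord0 i) *: d i = lincomb d c'.
  by apply: eq_bigr => i _; rewrite mxE.
have [c0|c0] := eqVneq (c 0 ord0) 0.
  rewrite c0 scale0r add0r => /id /rowP e; apply/rowP => i.
  case: (unliftP ord0 i) => [j ->|->]; rewrite [RHS]mxE //.
  by have := e j; rewrite !mxE.
move=> e; case: nx; exists (- (c 0 ord0)^-1 *: c').
rewrite (linZ (lincomb_linear d)) scaleNr -scalerN.
have -> : - lincomb d c' = c 0 ord0 *: x by apply/eqP; rewrite eq_sym -addr_eq0 e.
by rewrite scalerA mulVf // scale1r.
Qed.

Lemma fin_dim_finspan (S : set M) : fin_dim S -> finspan S.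
Proof.
move=> [n [b [Sb bP]]]; exists (codom b) => x /bP[c [-> _]].
apply: subspace_sum; first exact: span_subspace.
move=> i _ _; apply: (subspaceZ (span_subspace _)).
by apply: sub_span; rewrite /= codom_f.
Qed.

End FiniteDimension.

Section Dimension.
Variables (K : fieldType) (M N : lmodType K) (f : M -> N).
Variables (A : set M) (B : set N).
Hypotheses (lf : linear f) (sA : subspace A) (sB : subspace B).
Hypothesis fAB : f @` A = B.

(** Lifting a basis of [B] to [A] gives a matrix [G] with [G *m F = 1], where [F] is the matrix of
    [f]; hence the inequality. For square matrices a one-sided inverse is two-sided, whence
    injectivity on [A]. *)
Lemma has_dim_surj n m : has_dim A n -> has_dim B m ->
  (m <= n)%N /\ (m = n -> forall x, A x -> f x = 0 -> x = 0).
Proof.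
move=> /(has_dimP _ sA)[b [Ab ib bP]] /(has_dimP _ sB)[d [Bd id dP]].
have [F fF] : exists F : 'M[K]_(n, m), forall i, f (b i) = lincomb d (row i F).
  by apply: lincomb_matrix => i; apply: dP; rewrite -fAB; exists (b i).
have [G dG] : exists G : 'M[K]_(m, n), forall j, d j = lincomb (f \o b) (row j G).
  apply: lincomb_matrix => j; have : (f @` A) (d j) by rewrite fAB.
  move=> [a /bP[c ->] <-]; exists c; rewrite /lincomb lin_sum //.
  by apply: eq_bigr => i _; rewrite (linZ lf).
have GF : G *m F = 1%:M.
  apply/row_matrixP => j; apply/eqP; rewrite -subr_eq0; apply/eqP/id.
  rewrite (linB (lincomb_linear d)) row_mul -(lincomb_mul _ fF) -dG.
  by rewrite row1 lincomb_delta subrr.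
have rF : row_free G by apply/row_freeP; exists F.
split; first by rewrite -(eqP (rF : \rank G == m)) rank_leq_col.
move=> mn; subst m => x /bP[c ->].
rewrite /lincomb lin_sum //; under eq_bigr do rewrite (linZ lf).
rewrite -/(lincomb (f \o b) c) (lincomb_mul _ fF) => /id cF.
have : c *m (F *m G) = 0 by rewrite mulmxA cF mul0mx.
by rewrite (mulmx1C GF) mulmx1 => ->; exact: lin0 (lincomb_linear b).
Qed.

End Dimension.

Section VsDim.
Variables (K : fieldType) (M : lmodType K).

Lemma vs_dimP (A : set M) : fin_dim A -> has_dim A (vs_dim A).
Proof. by move=> [n An]; apply: (xgetPex 0%N); exists n. Qed.

End VsDim.

Section VsDimSurj.
Variables (K : fieldType) (M N : lmodType K) (f : M -> N).
Variables (A : set M) (B : set N).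
Hypotheses (lf : linear f) (sA : subspace A) (sB : subspace B).
Hypothesis fAB : f @` A = B.
Hypothesis fA : fin_dim A.

Lemma fin_dim_im : fin_dim B.
Proof.
apply: finspan_fin_dim => //; rewrite -fAB; apply: finspan_im => //.
exact: fin_dim_finspan.
Qed.

Lemma vs_dim_surj : (vs_dim B <= vs_dim A)%N.
Proof. exact: (has_dim_surj lf sA sB fAB (vs_dimP fA) (vs_dimP fin_dim_im)).1. Qed.

Lemma vs_dim_surj_inj : vs_dim B = vs_dim A -> forall x, A x -> f x = 0 -> x = 0.
Proof. exact: (has_dim_surj lf sA sB fAB (vs_dimP fA) (vs_dimP fin_dim_im)).2. Qed.

End VsDimSurj.

Section Decomposition.
Variables (K : fieldType) (M : lmodType K) (I : eqType) (G : I -> set M).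
Hypothesis sG : forall i, subspace (G i).

(* Any sufficiently large list of indices may be used, which makes two
   decompositions comparable. *)
Lemma span_bigcup_decomp x : span (\bigcup_i G i) x ->
  exists (s0 : seq I) (f : I -> M), (forall i, G i (f i)) /\
    forall s, uniq s -> {subset s0 <= s} -> x = \sum_(i <- s) f i.
Proof.
pose B := [set x | exists (s0 : seq I) (f : I -> M), (forall i, G i (f i)) /\
    forall s, uniq s -> {subset s0 <= s} -> x = \sum_(i <- s) f i].
apply: (span_sub (B := B)).
  split.
    exists [::], (fun=> 0); split=> [i|s _ _]; first exact: subspace0.
    by rewrite big1.
  move=> a y z [s0 [f [Gf yf]]] [t0 [h [Gh zh]]].
  exists (s0 ++ t0), (fun i => a *: f i + h i); split=> [i|s us ss].
    by apply: (proj2 (sG i)).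
  rewrite big_split -scaler_sumr -yf // -?zh // => i it; apply: ss;
    by rewrite mem_cat it ?orbT.
move=> y [i _ Gy]; exists [:: i], (fun j => if j == i then y else 0); split.
  by move=> j; case: eqP => [->//|_]; exact: subspace0.
move=> s us si; rewrite (bigD1_seq i) ?si ?inE //= eqxx big1 ?addr0 // => j ji.
by rewrite (negbTE ji).
Qed.

End Decomposition.

(** * Generalized eigenspaces *)

Section GeneralizedEigenspaces.
Variables (K : fieldType) (M : lmodType K) (D : M -> M).
Hypothesis lD : linear D.

Definition shift (l : K) (x : M) : M := D x - l *: x.

(** For [D] the operator [tw_L 0] this is convertible to [gen_eig], so what follows applies to
    weight spaces as it stands. *)
Definition geig (l : K) : set M := [set w | exists k, iter k (shift l) w = 0].

Lemma shift_linear l : linear (shift l).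
Proof.
move=> a x y; rewrite /shift lD scalerDr scalerBr opprD addrACA; congr (_ - _ + _).
by rewrite !scalerA mulrC.
Qed.

Lemma iter_linear k (f : M -> M) : linear f -> linear (iter k f).
Proof. by move=> lf a x y; elim: k => //= k ->; rewrite lf. Qed.

Lemma shiftC l m x : shift l (shift m x) = shift m (shift l x).
Proof.
rewrite /shift !(linB lD) !(linZ lD) !scalerBr !opprB !scalerA mulrC.
by rewrite -!addrA; congr (_ + _); rewrite addrCA [RHS]addrCA; congr (_ + _); rewrite addrC.
Qed.

Lemma iter_shiftC k j l m x :
  iter k (shift l) (iter j (shift m) x) = iter j (shift m) (iter k (shift l) x).
Proof.
have C y : iter k (shift l) (shift m y) = shift m (iter k (shift l) y).
  by elim: k => //= k ->; rewrite shiftC.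
by elim: j => //= j <-; rewrite C.
Qed.

Lemma iter_shift0 k l x j : iter k (shift l) x = 0 -> iter (j + k) (shift l) x = 0.
Proof. by rewrite iterD => ->; exact: lin0 (iter_linear j (shift_linear l)). Qed.

Lemma geig_subspace l : subspace (geig l).
Proof.
split; first by exists 0%N.
move=> a x y [k xk] [j yj]; exists (k + j)%N; rewrite (iter_linear _ (shift_linear l)).
by rewrite (iter_shift0 _ yj) addnC (iter_shift0 _ xk) scaler0 addr0.
Qed.

Lemma shift_geig l x : geig l (shift l x) -> geig l x.
Proof. by move=> [k xk]; exists k.+1; rewrite iterSr. Qed.

Section Modulo.
Variable S : set M.
Hypotheses (sS : subspace S) (DS : forall x, S x -> S (D x)).

Let shiftS l x : S x -> S (shift l x).
Proof. by move=> Sx; apply: (subspaceB sS); [exact: DS|apply: (subspaceZ sS)]. Qed.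

Let iterI k l x : S x -> S (iter k (shift l) x).
Proof. by move=> Sx; elim: k => //= k; apply: shiftS. Qed.

(** Two nested inductions on the exponents reduce to a vector whose two shifts both lie in [S];
    their difference is the nonzero multiple [m - l] of that vector. *)
Lemma geig_cap_mod l m k j x : l != m ->
  S (iter k (shift l) x) -> S (iter j (shift m) x) -> S x.
Proof.
move=> lm; elim: k j x => // k IH j x; rewrite iterSr => Skx Sjx.
have Slx : S (shift l x).
  by apply: (IH j) => //; have := iter_shiftC j 1 m l x; rewrite /= => ->; apply: shiftS.
elim: j {Skx} Sjx => // j IHj; rewrite iterS => Sj; apply: IHj.
set y := iter j _ x in Sj *.
have Sly : S (shift l y).
  by have := iter_shiftC 1 j l m x; rewrite /= -/y => ->; apply: iterI.
have : S ((m - l)^-1 *: (shift l y - shift m y)).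
  by apply: (subspaceZ sS); apply: (subspaceB sS).
have -> : shift l y - shift m y = (m - l) *: y.
  by rewrite /shift opprB scalerBl addrC addrA subrK.
rewrite scalerA mulVf ?scale1r //.
by rewrite subr_eq0 eq_sym.
Qed.

(** A power of [shift m] removes the summand at [m] modulo [S], and [geig_cap_mod] undoes that power
    on the others. For [S] zero this is independence of generalized eigenspaces; for [S] the image
    of a map it says that the components of a vector of [S] stay in [S]. *)
Lemma geig_indep_mod (s : seq K) (f : K -> M) : uniq s ->
  (forall l, l \in s -> exists k, S (iter k (shift l) (f l))) ->
  S (\sum_(l <- s) f l) -> forall l, l \in s -> S (f l).
Proof.
elim: s f => // m s IH f /= /andP[ms us] Gf; rewrite big_cons => Ssum.
have [j Sj] := Gf m (mem_head _ _).
have lj := iter_linear j (shift_linear m).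
have Sl l : l \in s -> S (f l).
  move=> ls; have [k Sk] := Gf l (mem_behead (s := _ :: _) ls).
  have lm : l != m by apply: contraNneq ms => <-.
  apply: (geig_cap_mod lm Sk (j := j)).
  apply: (IH (fun l => iter j (shift m) (f l))) ls => //.
    move=> l' l's; have [k' Sk'] := Gf l' (mem_behead (s := _ :: _) l's).
    by exists k'; rewrite iter_shiftC; apply: iterI.
  rewrite -(lin_sum lj).
  apply: (subspace_addr sS Sj); rewrite -(linD lj); exact: iterI.
move=> l; rewrite inE => /orP[/eqP ->|]; last exact: Sl.
apply: (subspace_addr sS (x := \sum_(l <- s) f l)); last by rewrite addrC.
by apply: (subspace_sum sS) => i si _; apply: Sl.
Qed.

End Modulo.

Lemma geig_indep (s : seq K) (f : K -> M) : uniq s ->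
  (forall l, l \in s -> geig l (f l)) -> \sum_(l <- s) f l = 0 ->
  forall l, l \in s -> f l = 0.
Proof.
move=> us Gf f0; apply: (geig_indep_mod (S := [set 0])) => //.
- exact: subspace_null.
- by move=> x ->; exact: lin0.
Qed.

Lemma geig_direct_sum :
  span (\bigcup_l geig l) = [set: M] <-> direct_sum geig.
Proof.
split=> [sp|[]//]; split=> //; [exact: geig_subspace|exact: geig_indep].
Qed.

(** Decompose [x] in [geig l] along [G], and subtract [x] from the component at [l]: the resulting
    family sums to zero, so by independence [x] is its own component in [G l]. *)
Lemma geig_full (G : K -> set M) : (forall l, subspace (G l)) ->
  (forall l, G l `<=` geig l) -> span (\bigcup_l G l) = [set: M] ->
  forall l, G l = geig l.
Proof.
move=> sG Gg sp l; apply/seteqP; split=> [|x gx]; first exact: Gg.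
have [s [f [Gf sf]]] : _ := span_bigcup_decomp sG (x := x) (eq_ind_r (@^~ x) I sp).
pose h m := f m - (if m == l then x else 0).
have us := undup_uniq (l :: s); have ls : l \in undup (l :: s).
  by rewrite mem_undup inE eqxx.
have : h l = 0.
  apply: (geig_indep us) ls => [m _|].
    apply: (subspaceB (geig_subspace m)); first exact/Gg/Gf.
    by case: eqP => [->//|_]; exact: subspace0 (geig_subspace m).
  rewrite sumrB -sf //; last by move=> i si; rewrite mem_undup inE si orbT.
  rewrite (bigD1_seq l) //; last by rewrite mem_undup inE eqxx.
  by rewrite eqxx big1 /= ?addr0 ?subrr // => m /negbTE ->.
by rewrite /h eqxx => /eqP; rewrite subr_eq0 => /eqP <-.
Qed.

End GeneralizedEigenspaces.

Section GeneralizedEigenspacesMap.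
Variables (K : fieldType) (M N : lmodType K) (D : M -> M) (E : N -> N) (f : M -> N).
Hypotheses (lD : linear D) (lE : linear E) (lf : linear f).
Hypothesis fD : forall x, f (D x) = E (f x).

Lemma iter_shift_map k l x : f (iter k (shift D l) x) = iter k (shift E l) (f x).
Proof.
elim: k => //= k <-; rewrite {1}/shift (linB lf) (linZ lf) fD //.
Qed.

Lemma geig_map l x : geig D l x -> geig E l (f x).
Proof. by move=> [k xk]; exists k; rewrite -iter_shift_map xk lin0. Qed.

Lemma geig_map_inj l x : injective f -> geig E l (f x) -> geig D l x.
Proof.
by move=> fi [k xk]; exists k; apply: fi; rewrite iter_shift_map xk lin0.
Qed.

Lemma geig_span_surj : f @` [set: M] = [set: N] ->
  span (\bigcup_l geig D l) = [set: M] -> span (\bigcup_l geig E l) = [set: N].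
Proof.
move=> fs sp; apply/seteqP; split=> // y _.
have : (f @` span (\bigcup_l geig D l)) y by rewrite sp fs.
move=> /(span_im lf); apply: span_mono => _ [x [l _ gx] <-].
by exists l => //; exact: geig_map.
Qed.

(** A preimage of a generalized eigenvector need not be one, so lifting is not immediate. The images
    of the spaces of [D] lie in those of [E] and span, hence fill them. *)
Lemma geig_im_surj l : f @` [set: M] = [set: N] ->
  span (\bigcup_l geig D l) = [set: M] -> f @` geig D l = geig E l.
Proof.
move=> fs sp; apply: (geig_full lE (G := fun l => f @` geig D l)).
- by move=> m; apply: subspace_im => //; exact: geig_subspace.
- by move=> m _ [x gx <-]; exact: geig_map.
apply/seteqP; split=> // y _.
have : (f @` span (\bigcup_l geig D l)) y by rewrite sp fs.
move=> /(span_im lf); apply: span_mono => _ [x [m _ gx] <-].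
by exists m => //; exists x.
Qed.

(** The image of [f] is stable under [E], so it contains the components of [f x]; these are pulled
    back one by one. *)
Lemma geig_span_inj : injective f ->
  span (\bigcup_l geig E l) = [set: N] -> span (\bigcup_l geig D l) = [set: M].
Proof.
move=> fi sp; apply/seteqP; split=> // x _.
have sS := subspace_im lf (S := [set: M]) (conj I (fun _ _ _ _ _ => I)).
have [s [h [Gh sh]]] :=
  span_bigcup_decomp (geig_subspace lE) (x := f x) (eq_ind_r (@^~ (f x)) I sp).
have fx : f x = \sum_(l <- undup s) h l.
  by apply: sh; [exact: undup_uniq|move=> i; rewrite mem_undup].
have Sh l : l \in undup s -> (f @` [set: M]) (h l).
  apply: (geig_indep_mod lE sS _ (undup_uniq s)) => [_ [y _ <-]|m ms|].
  - by exists (D y).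
  - by have [k hk] := Gh m; exists k; rewrite hk; exact: subspace0.
  - by rewrite -fx; exists x.
pose g l : M := xget 0 [set y | f y = h l].
have fg l : l \in undup s -> f (g l) = h l.
  by rewrite /g => /Sh[y _ fy]; case: xgetP => [z _ //|] /(_ y).
have -> : x = \sum_(l <- undup s) g l.
  apply: fi; rewrite lin_sum // fx big_seq [RHS]big_seq.
  by apply: eq_bigr => l /fg ->.
apply: (subspace_sum (span_subspace _)) => l ls _; apply: sub_span; exists l => //.
by apply: (geig_map_inj fi); rewrite fg.
Qed.

End GeneralizedEigenspacesMap.

(** * Eigenspaces of automorphisms *)

Section Cis.
Variable R : realType.

Lemma cisD (a b : R) : cis (a + b) = cis a * cis b.
Proof.
rewrite /cis cosD sinD; apply/eqP; rewrite eq_complex /= eqxx /=.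
by apply/eqP; ring.
Qed.

Lemma cis0 : cis (0 : R) = 1.
Proof. by rewrite /cis cos0 sin0. Qed.

Lemma cis_neq0 (a : R) : cis a != 0.
Proof.
apply/eqP => a0; have : cis (a - a) = 0 by rewrite cisD a0 mul0r.
by rewrite subrr cis0 => /eqP; rewrite oner_eq0.
Qed.

Lemma cisN (a : R) : cis (- a) = (cis a)^-1.
Proof.
by apply: (mulfI (cis_neq0 a)); rewrite -cisD subrr cis0 mulfV ?cis_neq0.
Qed.

Lemma cisMn (a : R) n : cis (a * n%:R) = cis a ^+ n.
Proof.
elim: n => [|n IH]; first by rewrite mulr0 cis0.
by rewrite -natr1 mulrDr mulr1 cisD IH exprSr.
Qed.

Lemma cis2pi : cis (2 * pi : R) = 1.
Proof. by rewrite mulr_natl /cis cos2pi sin2pi. Qed.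

Lemma cis_int (k : int) : cis (2 * pi * k%:~R : R) = 1.
Proof.
case: k => n; first by rewrite cisMn cis2pi expr1n.
by rewrite NegzE mulrNz mulrN cisN cisMn cis2pi expr1n invr1.
Qed.

(** For the fractional part [f] of [x] the double angle formula gives [sin (pi * f) ^+ 2 = 0], while
    the sine is positive strictly between 0 and [pi]. *)
Lemma cis_eq1 (x : R) : cis (2 * pi * x) = 1 -> exists k : int, x = k%:~R.
Proof.
move=> x1; exists (Num.floor x).
have /andP[f0 f1] := floor_itv x; set k := Num.floor x in f0 f1 *.
pose f := x - k%:~R; have xE : x = f + k%:~R by rewrite /f subrK.
move: x1; rewrite {1}xE mulrDr cisD cis_int mulr1 => - [c1 _].
move: c1; rewrite -mulrA mulr_natl cos_mulr2n => c1.
have s0 : sin (pi * f) ^+ 2 = 0 by rewrite sin2cos2; lra.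
have [fp|] := ltP 0 f; last by rewrite xE; move: f0; rewrite -subr_ge0 -/f; lra.
have := @sin_gt0_pi _ (pi * f); rewrite mulr_gt0 ?pi_gt0 //=.
rewrite gtr_pMr ?pi_gt0 // /f ltrBlDr addrC -intrD1 f1 => /(_ isT).
by rewrite lt0r -sqrf_eq0 s0 eqxx.
Qed.

End Cis.

Section VoaGrading.
Variables (R : realType) (V : voa R).
Implicit Types u v : V.

Lemma voa_grade_subspace n : subspace (@voa_grade R V n).
Proof. by case: (voa_direct_sum V). Qed.

(** $L(0)$ acts on distinct homogeneous components by distinct scalars. Membership thus becomes an
    equation, which can be checked for images under $L(-1)$ and under automorphisms. *)
Lemma voa_gradeP n v :
  voa_grade n v <-> voa_mode (voa_omega V) 1 v = n%:~R *: v.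
Proof.
split=> [/voa_L0//|Lv]; have [sG sp ind] := voa_direct_sum V.
have [s0 [f [Gf sf]]] := span_bigcup_decomp sG (x := v) (eq_ind_r (@^~ v) I sp).
pose s := undup (n :: s0); have us : uniq s := undup_uniq _.
have vs : v = \sum_(m <- s) f m.
  by apply: sf => // m ms; rewrite mem_undup inE ms orbT.
have lL := voa_mode_linearr (voa_omega V) 1.
have f0 m : m \in s -> (m - n)%:~R *: f m = 0.
  apply: (ind s (fun m => (m - n)%:~R *: f m)) => //.
    by move=> i _; apply: (subspaceZ (sG i)).
  transitivity (voa_mode (voa_omega V) 1 v - n%:~R *: v); last by rewrite Lv subrr.
  rewrite vs (lin_sum lL) scaler_sumr -sumrB. apply: eq_bigr => i _.
  by rewrite (voa_L0 (Gf i)) -scalerBl intrB.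
suff -> : v = f n by [].
rewrite vs (bigD1_seq n) //=; last by rewrite mem_undup inE eqxx.
rewrite big_seq_cond big1 ?addr0 // => m /andP[ms mn].
move/eqP: (f0 _ ms); rewrite scaler_eq0 intr_eq0 subr_eq0 (negbTE mn) /=.
by move/eqP.
Qed.

(** The operator $L(-1)$ on $V$, as $L(n)=\omega_{n+1}$. *)
Definition voa_Lm (v : V) : V := voa_mode (voa_omega V) 0 v.

(** This is $[L(0),L(-1)]=L(-1)$; the central term vanishes because the indices sum to $-1$. *)
Lemma voa_Lm_grade n v : voa_grade n v -> voa_grade (n + 1) (voa_Lm v).
Proof.
move=> nv; apply/voa_gradeP; rewrite /voa_Lm.
have := @voa_virasoro R V 0 (-1)%R v; rewrite !add0r !addNr.
rewrite (voa_L0 nv) (linZ (voa_mode_linearr _ _)) /= scale0r addr0 scale1r.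
by move/eqP; rewrite subr_eq intrD scalerDl scale1r addrC => /eqP.
Qed.

Lemma voa_LmE v : voa_Lm v = voa_mode v (-2) (voa_vac V).
Proof.
have [<- _] := voa_creation (voa_Lm v).
by rewrite voa_Lm1 mulrN1z opprK scale1r.
Qed.

Variable g : fin_aut V.

Lemma aut_grade n v : voa_grade n v -> voa_grade n (g v).
Proof.
move=> nv; apply/voa_gradeP.
by rewrite -{1}(aut_omega g) -aut_mode (voa_L0 nv) (linZ (aut_linear g)).
Qed.

Lemma aut_eig_subspace r : subspace (aut_eig g r).
Proof.
split; first by rewrite /aut_eig /= (lin0 (aut_linear g)) scaler0.
by move=> a x y /= xr yr; rewrite /aut_eig /= (aut_linear g) xr yr scalerDr !scalerA mulrC.
Qed.

Lemma aut_eig_self r v : aut_eig g r v -> aut_eig g r (g v).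
Proof. by rewrite /aut_eig /= => vr; rewrite {1}vr (linZ (aut_linear g)). Qed.

Lemma aut_eig_omega : aut_eig g 0 (voa_omega V).
Proof. by rewrite /aut_eig /= /root_frac mul0r mulr0 oppr0 cis0 scale1r aut_omega. Qed.

Lemma aut_eig_Lm r v : aut_eig g r v -> aut_eig g r (voa_Lm v).
Proof.
rewrite /aut_eig /= /voa_Lm => vr.
by rewrite aut_mode aut_omega vr (linZ (voa_mode_linearr _ _)).
Qed.

Local Notation T := (aut_order g).

Lemma aut_order_neq0 (F : numFieldType) : T%:R != 0 :> F.
Proof. by rewrite pnatr_eq0 -lt0n aut_order_gt0. Qed.

(** A geometric sum in $z=e^{2\pi i j/T}$, where $z^T=1$ and $z\neq1$ for $0<j<T$. *)
Lemma cis_root_sum (j : nat) : (j < T)%N ->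
  \sum_(r < T) cis (2 * pi * root_frac R r T * j%:R) = (T * (j == 0))%:R.
Proof.
move=> jT; pose z := cis (2 * pi * root_frac R j T).
have zE r : cis (2 * pi * root_frac R r T * j%:R) = z ^+ r.
  by rewrite /z -cisMn /root_frac; congr cis; ring.
under eq_bigr do rewrite zE.
have [j0|j0] := eqVneq j 0%N.
  rewrite /z j0 /root_frac mul0r mulr0 cis0.
  by under eq_bigr do rewrite expr1n; rewrite sumr_const card_ord muln1.
rewrite muln0; have zT : z ^+ T = 1.
  rewrite /z -cisMn -mulrA /root_frac divfK ?aut_order_neq0 //.
  exact: (cis_int _ j%:Z).
have : (z - 1) * \sum_(r < T) z ^+ r = 0 by rewrite -subrX1 zT subrr.
move/eqP; rewrite mulf_eq0 subr_eq0 => /orP[/eqP /cis_eq1[k]|/eqP //].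
move/eqP; rewrite /root_frac; have T0 := aut_order_neq0 R.
rewrite -(inj_eq (mulIf T0)) divfK // => /eqP jk.
have : (j%:Z)%:~R = (k * T%:Z)%:~R :> R by rewrite intrM.
move=> /intr_inj jkT; exfalso; set n := T in jT jkT *.
have [k0|k0] : (k <= 0) \/ (1 <= k) by lia.
  by nia.
by nia.
Qed.

(** The components are given by the projections $\frac1T\sum_j e^{2\pi i rj/T}g^j$. They preserve
    any [g]-stable subspace [S], which allows decomposing again inside a weight space or an
    eigenspace of another automorphism. *)
Lemma aut_decomp (S : set V) v : subspace S -> (forall x, S x -> S (g x)) -> S v ->
  exists f : nat -> V, v = \sum_(r < T) f r /\
    forall r, S (f r) /\ aut_eig g r (f r).
Proof.
move=> sS gS Sv; pose c r := cis (2 * pi * root_frac R r T).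
exists (fun r => T%:R^-1 *: \sum_(j < T) c r ^+ j *: iter j g v); split.
  rewrite -scaler_sumr exchange_big /=.
  have E (j : 'I_T) : \sum_(r < T) c r ^+ j *: iter j g v
      = (T * (j == 0 :> nat))%:R *: iter j g v.
    rewrite -scaler_suml -cis_root_sum //; congr (_ *: _).
    by apply: eq_bigr => r _; rewrite cisMn.
  under eq_bigr do rewrite E.
  rewrite (bigD1 (Ordinal (aut_order_gt0 g))) //= big1 => [|j j0].
    by rewrite muln1 addr0 scalerA mulVf ?aut_order_neq0 // scale1r.
  by move: j0; rewrite -(inj_eq val_inj) /= => /negbTE ->; rewrite muln0 scale0r.
move=> r; split.
  apply: (subspaceZ sS); apply: (subspace_sum sS) => j _ _; apply: (subspaceZ sS).
  by elim: (j : nat) => //= k; exact: gS.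
rewrite /aut_eig /= (linZ (aut_linear g)) scalerA mulrC -scalerA; congr (_ *: _).
rewrite (lin_sum (aut_linear g)) cisN -/(c r) scaler_sumr.
have c0 : c r != 0 by exact: cis_neq0.
have cT : c r ^+ T = 1.
  rewrite /c -cisMn -mulrA /root_frac divfK ?aut_order_neq0 //.
  exact: (cis_int _ r%:Z).
(* Applying [g] shifts the summation index by one, which is harmless over a full period since
   [F T = F 0]. *)
pose F (j : nat) := (c r)^-1 *: (c r ^+ j *: iter j g v).
transitivity (\sum_(j < T) F j.+1).
  apply: eq_bigr => j _; rewrite /F /= (linZ (aut_linear g)) scalerA.
  by rewrite exprS mulKf.
have E : F T = F 0%N by rewrite /F cT aut_orderP expr0.
have H : F 0%N + \sum_(j < T) F j.+1 = \sum_(j < T) F j + F T.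
  by rewrite -(big_ord_recr T (fun j => F j)) big_ord_recl.
by apply: (addrI (F 0%N)); rewrite H E addrC.
Qed.

End VoaGrading.

Section VoaJointEigenspaces.
Variables (R : realType) (V : voa R) (g1 g2 g3 : fin_aut V).
Hypothesis g12 : forall v, g1 (g2 v) = g2 (g1 v).
Hypothesis g3E : forall v, g3 v = g1 (g2 v).

Definition joint_eig (r1 r2 : nat) : set V := aut_eig g1 r1 `&` aut_eig g2 r2.

Lemma aut_eig_commute r v : aut_eig g1 r v -> aut_eig g1 r (g2 v).
Proof.
by rewrite /aut_eig /= g12 => ->; rewrite (linZ (aut_linear g2)).
Qed.

(** With [x] the sum of the two fractions, [g3] scales [v] by $e^{-2\pi i x}$. As [v] is nonzero and
    [g3] has order [T], the product [x * T] is an integer; since $0\le x<2$, reducing it below [T]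
    costs a carry [e] of at most one. *)
Lemma aut_eig_prod r1 r2 v : (r1 < aut_order g1)%N -> (r2 < aut_order g2)%N ->
  aut_eig g1 r1 v -> aut_eig g2 r2 v -> v != 0 ->
  exists r3 (e : bool), [/\ (r3 < aut_order g3)%N, aut_eig g3 r3 v &
    root_frac R r1 (aut_order g1) + root_frac R r2 (aut_order g2)
      = root_frac R r3 (aut_order g3) + e%:R].
Proof.
move=> r1T r2T e1 e2 v0; set x := _ + _; set T := aut_order g3.
have fr_itv (g : fin_aut V) r : (r < aut_order g)%N -> 0 <= root_frac R r (aut_order g) < 1.
  move=> rT; rewrite /root_frac divr_ge0 ?ler0n //= ltr_pdivrMr ?mul1r ?ltr_nat //.
  by rewrite ltr0n aut_order_gt0.
have /andP[x1 x1'] := fr_itv _ _ r1T; have /andP[x2 x2'] := fr_itv _ _ r2T.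
have gv : g3 v = cis (2 * pi * - x) *: v.
  rewrite g3E (e2 : g2 v = _) (linZ (aut_linear g1)) (e1 : g1 v = _) scalerA -cisD.
  by congr (cis _ *: _); rewrite /x; ring.
have T0 := aut_order_neq0 g3 R.
have [k xk] : exists k : int, x * T%:R = k%:~R.
  have [k xk] : exists k : int, (- x) * T%:R = k%:~R.
    apply: cis_eq1; rewrite mulrA cisMn.
    have gn n : iter n g3 v = cis (2 * pi * - x) ^+ n *: v.
      elim: n => [|n /= ->]; first by rewrite scale1r.
      by rewrite (linZ (aut_linear g3)) gv scalerA -exprSr.
    have := aut_orderP g3 v; rewrite gn => /eqP.
    rewrite -subr_eq0 -{2}[v]scale1r -scalerBl scaler_eq0 (negbTE v0) orbF subr_eq0.
    by move/eqP.
  by exists (- k); rewrite mulrNz -xk mulNr opprK.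
have Tp : 0 < T%:R :> R by rewrite ltr0n aut_order_gt0.
have k0 : 0 <= k by rewrite -(ler0z R) -xk; apply: mulr_ge0 (addr_ge0 x1 x2) (ltW Tp).
have k2 : k < (2 * T)%N.
  have E : (Posz (2 * T))%:~R = 2 * T%:R :> R by rewrite -natrM.
  by rewrite -(ltr_int R) -xk E ltr_pM2r // /x; lra.
case: k xk k0 k2 => // k xk _ kT.
have xE : x = k%:R / T%:R by rewrite -[k%:R]/((Posz k)%:~R) -xk mulfK.
have [kT1|kT1] := ltnP k T.
  exists k, false; split=> //; last by rewrite addr0.
  by rewrite /aut_eig /= gv xE /root_frac mulrN.
have Tk : x = root_frac R (k - T) T + 1.
  by rewrite /root_frac natrB // mulrBl divff // subrK.
exists (k - T)%N, true; split=> //; first by rewrite /T in kT kT1 *; lia.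
rewrite /aut_eig /= gv Tk; congr (_ *: _).
by rewrite mulrN mulrDr opprD cisD -(mulrN _ 1) (cis_int _ (-1)) mulr1.
Qed.

(** Reduces a condition linear in [v] to joint eigenvectors. The set [S] carries a side condition
    stable under both automorphisms, such as homogeneity, which the components inherit. *)
Lemma joint_decomp (B : set V) (S : set V) v :
  subspace S -> (forall x, S x -> S (g1 x)) -> (forall x, S x -> S (g2 x)) ->
  subspace B ->
  (forall r1 r2 x, (r1 < aut_order g1)%N -> (r2 < aut_order g2)%N ->
     S x -> joint_eig r1 r2 x -> B x) ->
  S v -> B v.
Proof.
move=> sS g1S g2S sB SB Sv.
have [f [-> fP]] := aut_decomp sS g1S Sv.
apply: (subspace_sum sB) => r1 _ _; have [Sf f1] := fP r1.
have [|||h [-> hP]] := @aut_decomp _ _ g2 (S `&` aut_eig g1 r1) (f r1).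
- by apply: subspace_setI => //; exact: aut_eig_subspace.
- by move=> x [Sx x1]; split; [exact: g2S|exact: aut_eig_commute].
- by split.
apply: (subspace_sum sB) => r2 _ _; have [[Sh h1] h2] := hP r2.
by apply: (SB r1 r2).
Qed.

End VoaJointEigenspaces.

(** * Subspaces and quotients as vector spaces *)

Section SubLmod.
Variables (K : fieldType) (M : lmodType K) (S : set M).
Hypothesis sS : subspace S.

Definition in_subspace : {pred M} := fun x => `[< S x >].

Lemma in_subspace_closed : submod_closed in_subspace.
Proof.
split; first by apply/asboolP; exact: subspace0.
by move=> a x y /asboolP Sx /asboolP Sy; apply/asboolP; apply: (proj2 sS).
Qed.

HB.instance Definition _ := GRing.isSubmodClosed.Build K M in_subspace in_subspace_closed.

Definition sub_lmod := {x : M | in_subspace x}.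
HB.instance Definition _ := SubChoice.on sub_lmod.
HB.instance Definition _ := [SubChoice_isSubLmodule of sub_lmod by <:].

Lemma sub_lmodP : exists (L : lmodType K) (f : L -> M),
  [/\ linear f, injective f & forall x, S x <-> exists y, f y = x].
Proof.
exists sub_lmod, val; split; [exact: linearP|exact: val_inj|].
move=> x; split=> [Sx|[y <-]]; last by apply/asboolP; exact: (valP y).
by exists (Sub x (asboolT Sx)); rewrite SubK.
Qed.

Local Notation Q := (Quotient.quot (in_subspace : zmodClosed M)).
Local Open Scope quotient_scope.

Let pi (x : M) : Q := \pi_Q x.

Let piP x y : (pi x = pi y) <-> S (x - y).
Proof.
by split=> [/eqP|/asboolP xy]; [|apply/eqP]; rewrite -Quotient.idealrBE => // /asboolP.
Qed.

Let piD x y : pi (x + y) = pi x + pi y.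
Proof. by rewrite /pi !piE. Qed.

Definition quot_scale (a : K) (x : Q) : Q := pi (a *: repr x).

Let pi_repr (x : Q) : pi (repr x) = x. Proof. exact: reprK. Qed.

Let piZ a x : quot_scale a (pi x) = pi (a *: x).
Proof.
by apply/piP; rewrite -scalerBr; apply: (subspaceZ sS); apply/piP.
Qed.

Lemma quot_scaleA a b v : quot_scale a (quot_scale b v) = quot_scale (a * b) v.
Proof. by rewrite -[v]pi_repr !piZ scalerA. Qed.

Lemma quot_scale1 : left_id 1 quot_scale.
Proof. by move=> v; rewrite -[v]pi_repr !piZ scale1r. Qed.

Lemma quot_scaleDr : right_distributive quot_scale +%R.
Proof. by move=> a u v; rewrite -[u]pi_repr -[v]pi_repr -piD !piZ scalerDr piD. Qed.

Lemma quot_scaleDl v : {morph quot_scale^~ v : a b / a + b}.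
Proof. by move=> a b; rewrite -[v]pi_repr !piZ scalerDl piD. Qed.

HB.instance Definition _ := GRing.Zmodule_isLmodule.Build K Q
  quot_scaleA quot_scale1 quot_scaleDr quot_scaleDl.

Lemma quot_lmodP : exists (L : lmodType K) (f : M -> L),
  [/\ linear f, forall y, exists x, f x = y & forall x, f x = 0 <-> S x].
Proof.
exists Q, pi; split=> [a x y|y|x].
- by rewrite piD -piZ.
- by exists (repr y).
- by have := piP x 0; rewrite subr0 /pi !piE.
Qed.

End SubLmod.

Lemma fsum_nat (M : nmodType) (F : nat -> M) (N : nat) :
  (forall i, (N <= i)%N -> F i = 0) ->
  \sum_(i \in [set: nat]) F i = \sum_(0 <= i < N) F i.
Proof.
move=> F0; rewrite big_mkord fsbig_ord; apply/esym/fsbig_widen => // i [_ /=] iN.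
by apply: F0; rewrite leqNgt; apply/negP.
Qed.

(** * Submodules and quotients of twisted modules *)

Section TruncatedJacobi.
Variables (R : realType) (V : voa R) (g : fin_aut V) (M : lmodType R[i]).
Variable mode : V -> R[i] -> M -> M.

(** [jac_left], [jac_right] and [jac_iter] truncate the three sums of the Jacobi identity at [N]. As
    ordinary finite sums over a bare map [mode] they are carried along by linear maps compatible
    with the modes, before any module structure is available. *)
Definition jac_left (v u : V) (w : M) (l : int) (p q : R[i]) (N : nat) : M :=
  \sum_(0 <= i < N) ((-1) ^+ i * cbinom l%:~R i) *:
     mode v (p + l%:~R - i%:R) (mode u (q + i%:R) w).

Definition jac_right (v u : V) (w : M) (l : int) (p q : R[i]) (N : nat) : M :=
  \sum_(0 <= i < N) ((-1) ^ l * (-1) ^+ i * cbinom l%:~R i) *: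
     mode u (q + l%:~R - i%:R) (mode v (p + i%:R) w).

Definition jac_iter (v u : V) (w : M) (l : int) (p q : R[i]) (N : nat) : M :=
  \sum_(0 <= i < N) cbinom p i *:
     mode (voa_mode v (l + i%:Z) u) (p + q - i%:R) w.

Local Notation coset r := (root_frac R r (aut_order g))%:C.

(* The truncation condition makes all sums in the Jacobi identity finite; here
   it is imposed on arbitrary vectors and modes. *)
Record tw_axioms : Prop := TwAxioms {
  ta_linearl : forall n w, linear (fun v => mode v n w);
  ta_linearr : forall v n, linear (mode v n);
  ta_support : forall v (n : R[i]) w,
    (forall k : int, n != k%:~R / (aut_order g)%:R) -> mode v n w = 0;
  ta_vacuum : forall n w, mode (voa_vac V) n w = if n == -1 then w else 0;
  ta_grading : forall (r : nat) v (n : R[i]) w,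
    (r < aut_order g)%N -> aut_eig g r v ->
    (forall k : int, n != k%:~R - coset r) -> mode v n w = 0;
  ta_truncation : forall v n w, exists N : nat, forall i, (N <= i)%N ->
    mode v (n + i%:R) w = 0;
  ta_jacobi : forall (r : nat) (v u : V) (w : M) (l m : int) (q : R[i]),
    (r < aut_order g)%N -> aut_eig g r v ->
    exists N0 : nat, forall N, (N0 <= N)%N ->
      jac_left v u w l (m%:~R - coset r) q N
        - jac_right v u w l (m%:~R - coset r) q N
      = jac_iter v u w l (m%:~R - coset r) q N
}.

Section FiniteSums.
Hypothesis ml : forall n w, linear (fun v => mode v n w).
Hypothesis mr : forall v n, linear (mode v n).
Hypothesis mt : forall v n w, exists N : nat, forall i, (N <= i)%N ->
  mode v (n + i%:R) w = 0.

Lemma jac_fsum v u w l p q : exists N0 : nat, forall N, (N0 <= N)%N ->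
  [/\ \sum_(i \in [set: nat]) ((-1) ^+ i * cbinom l%:~R i) *:
        mode v (p + l%:~R - i%:R) (mode u (q + i%:R) w) = jac_left v u w l p q N,
      \sum_(i \in [set: nat]) ((-1) ^ l * (-1) ^+ i * cbinom l%:~R i) *:
        mode u (q + l%:~R - i%:R) (mode v (p + i%:R) w) = jac_right v u w l p q N
    & \sum_(i \in [set: nat]) cbinom p i *:
        mode (voa_mode v (l + i%:Z) u) (p + q - i%:R) w = jac_iter v u w l p q N].
Proof.
have [N1 h1] := mt u q w; have [N2 h2] := mt v p w.
have [N3 h3] := voa_truncation v u.
exists (maxn (maxn N1 N2) `|N3 - l|%N) => N; rewrite !geq_max => /andP[/andP[N1N N2N] N3N].
split; apply: fsum_nat => i Ni.
- by rewrite h1 ?(leq_trans _ Ni) // (lin0 (mr _ _)) scaler0.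
- by rewrite h2 ?(leq_trans _ Ni) // (lin0 (mr _ _)) scaler0.
- by rewrite h3 ?(lin0 (ml _ _)) ?scaler0 //; lia.
Qed.

End FiniteSums.

(** Transparent, because later constructions rely on the carrier and the modes being [M] and [mode]
    by conversion. *)
Definition tw_of_axioms (ax : tw_axioms) : twisted_module g.
Proof.
refine (@TwistedModule R V g M mode (ta_linearl ax) (ta_linearr ax) (ta_support ax)
  (ta_vacuum ax) (ta_grading ax) _ _).
- move=> r v w rT vr; have [N hN] := ta_truncation ax v (- coset r) w.
  exists N%:Z => k Nk; have [i ki] : exists i : nat, k = i%:Z.
    by exists `|k|%N; lia.
  by rewrite ki addrC hN //; lia.
- move=> r v u w l m q rT vr p.
  have [N1 h1] := ta_jacobi ax u w l m q rT vr.
  have [N2 h2] := jac_fsum (ta_linearl ax) (ta_linearr ax) (ta_truncation ax)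
    v u w l (m%:~R - coset r) q.
  have [-> -> ->] := h2 _ (leq_maxr N1 N2).
  exact: h1 (leq_maxl _ _).
Defined.

End TruncatedJacobi.

Section TwistedModuleAxioms.
Variables (R : realType) (V : voa R) (g : fin_aut V) (W : twisted_module g).

(** The module axiom covers eigenvectors and indices in their coset. Outside the coset the modes
    vanish, and a general [v] is a finite sum of eigenvectors. *)
Lemma tw_trunc (v : V) n (w : W) : exists N : nat, forall i, (N <= i)%N ->
  tw_mode v (n + i%:R) w = 0.
Proof.
pose B := [set v | exists N : nat, forall i, (N <= i)%N ->
  tw_mode v (n + i%:R) w = 0].
have sB : subspace B.
  split; first by exists 0%N => i _; exact: lin0 (tw_mode_linearl _ _).
  move=> a x y [N1 h1] [N2 h2]; exists (maxn N1 N2) => i; rewrite geq_max => /andP[i1 i2].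
  by rewrite (tw_mode_linearl (n + i%:R) w) h1 // h2 // scaler0 addr0.
have [f [-> fP]] := @aut_decomp _ _ g setT v (conj I (fun _ _ _ _ _ => I))
  (fun _ _ => I) I.
apply: (subspace_sum sB) => r _ _; have [_ fr] := fP r.
have [N hN] := tw_truncation w (ltn_ord r) fr.
have [[k nk]|nk] := pselect (exists k : int, n = k%:~R - (root_frac R r (aut_order g))%:C).
  exists `|N - k|%N => i Ni.
  have -> : n + i%:R = (k + i%:Z)%:~R - (root_frac R r (aut_order g))%:C.
    by rewrite nk intrD addrAC.
  by apply: hN; lia.
exists 0%N => i _; apply: (tw_grading _ (ltn_ord r) fr) => k.
apply/eqP => nik; apply: nk; exists (k - i%:Z).
by rewrite intrB addrAC -nik addrK.
Qed.

Lemma tw_module_axioms : tw_axioms g (@tw_mode _ _ _ W).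
Proof.
split.
- exact: tw_mode_linearl.
- exact: tw_mode_linearr.
- exact: tw_support.
- exact: tw_vacuum.
- exact: tw_grading.
- exact: tw_trunc.
- move=> r v u w l m q rT vr; have := tw_jacobi u w l m q rT vr => /=.
  have [N h] := jac_fsum (@tw_mode_linearl _ _ _ W) (@tw_mode_linearr _ _ _ W) tw_trunc
    v u w l (m%:~R - (root_frac R r (aut_order g))%:C) q.
  by move=> J; exists N => N' /h [<- <- <-].
Qed.

End TwistedModuleAxioms.

Section Transfer.
Variables (R : realType) (V : voa R) (g : fin_aut V).

Section JacMap.
Variables (M M' : lmodType R[i]) (mode : V -> R[i] -> M -> M) (mode' : V -> R[i] -> M' -> M').
Variable f : M -> M'.
Hypotheses (lf : linear f) (fm : forall v n w, f (mode v n w) = mode' v n (f w)).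

Lemma jac_map v u w l p q N :
  [/\ f (jac_left mode v u w l p q N) = jac_left mode' v u (f w) l p q N,
      f (jac_right mode v u w l p q N) = jac_right mode' v u (f w) l p q N
    & f (jac_iter mode v u w l p q N) = jac_iter mode' v u (f w) l p q N].
Proof.
by split; rewrite /jac_left /jac_right /jac_iter lin_sum //;
  apply: eq_bigr => i _; rewrite linZ // !fm.
Qed.

End JacMap.

Variables (W1 W2 : twisted_module g) (M : lmodType R[i]) (mode : V -> R[i] -> M -> M).

Section Embed.
Variables (f1 : M -> W1) (f2 : M -> W2).
Hypotheses (lf1 : linear f1) (lf2 : linear f2).
Hypothesis fm1 : forall v n w, f1 (mode v n w) = tw_mode v n (f1 w).
Hypothesis fm2 : forall v n w, f2 (mode v n w) = tw_mode v n (f2 w).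
Hypothesis f12 : forall x y, f1 x = f1 y -> f2 x = f2 y -> x = y.

(** Each axiom is an identity or a vanishing statement, hence is detected by two compatible maps
    that are jointly injective; truncation bounds are maxima of the two given ones. *)
Lemma tw_axioms_embed : tw_axioms g mode.
Proof.
have mr v n : linear (mode v n).
  by move=> a x y; apply: f12; rewrite ?fm1 ?fm2 ?lf1 ?lf2 tw_mode_linearr ?fm1 ?fm2.
have z n w v : tw_mode v n (f1 w) = 0 -> tw_mode v n (f2 w) = 0 -> mode v n w = 0.
  by move=> h1 h2; apply: f12; rewrite ?fm1 ?fm2 ?h1 ?h2 lin0.
split=> //.
- move=> n w a x y.
  by apply: f12; rewrite ?fm1 ?fm2 ?lf1 ?lf2 tw_mode_linearl ?fm1 ?fm2.
- by move=> v n w h; apply: z; apply: tw_support.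
- by move=> n w; apply: f12; rewrite ?fm1 ?fm2 tw_vacuum; case: eqP => // _; rewrite lin0.
- by move=> r v n w rT vr h; apply: z; apply: tw_grading rT vr h.
- move=> v n w; have [N1 h1] := tw_trunc v n (f1 w); have [N2 h2] := tw_trunc v n (f2 w).
  exists (maxn N1 N2) => i; rewrite geq_max => /andP[i1 i2].
  by apply: z; [exact: h1|exact: h2].
- move=> r v u w l m q rT vr.
  have [N1 h1] := ta_jacobi (tw_module_axioms W1) u (f1 w) l m q rT vr.
  have [N2 h2] := ta_jacobi (tw_module_axioms W2) u (f2 w) l m q rT vr.
  exists (maxn N1 N2) => N; rewrite geq_max => /andP[/h1 e1 /h2 e2].
  set p := m%:~R - _ in e1 e2 *.
  have [a1 b1 c1] := jac_map lf1 fm1 v u w l p q N.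
  have [a2 b2 c2] := jac_map lf2 fm2 v u w l p q N.
  by apply: f12; rewrite linB // ?a1 ?a2 ?b1 ?b2 ?c1 ?c2.
Qed.

End Embed.

Section Quot.
Variable f : W1 -> M.
Hypotheses (lf : linear f) (fs : forall y, exists x, f x = y).
Hypothesis fm : forall v n w, f (tw_mode v n w) = mode v n (f w).

Lemma tw_axioms_quot : tw_axioms g mode.
Proof.
split.
- by move=> n w a x y; have [w' <-] := fs w; rewrite -!fm tw_mode_linearl lf.
- move=> v n a x y; have [x' <-] := fs x; have [y' <-] := fs y.
  by rewrite -lf -!fm tw_mode_linearr lf.
- by move=> v n w h; have [w' <-] := fs w; rewrite -fm tw_support // lin0.
- move=> n w; have [w' <-] := fs w; rewrite -fm tw_vacuum; case: eqP => // _.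
  exact: lin0.
- by move=> r v n w rT vr h; have [w' <-] := fs w; rewrite -fm (tw_grading _ rT vr h) lin0.
- move=> v n w; have [w' <-] := fs w; have [N hN] := tw_trunc v n w'.
  by exists N => i iN; rewrite -fm hN // lin0.
- move=> r v u w l m q rT vr; have [w' <-] := fs w.
  have [N h] := ta_jacobi (tw_module_axioms W1) u w' l m q rT vr.
  exists N => N' /h; set p := m%:~R - _ => e.
  have [<- <- <-] := jac_map lf fm v u w' l p q N'.
  by rewrite -linB // e.
Qed.

End Quot.

End Transfer.

Section SubQuotient.
Variables (R : realType) (V : voa R) (g : fin_aut V).

(** One construction serves twice: [S] everything gives the direct sum, and the diagonal copy of a
    submodule inside [Q * Q] gives the submodule as a module. *)
Lemma tw_sub_prod (P W : twisted_module g) (S : set (P * W)%type) :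
  subspace S ->
  (forall v n x, S x -> S (tw_mode v n x.1, tw_mode v n x.2)) ->
  exists (U : twisted_module g) (f1 : U -> P) (f2 : U -> W),
    [/\ tw_hom f1, tw_hom f2, forall x, S x <-> exists y, (f1 y, f2 y) = x
      & forall x y, f1 x = f1 y -> f2 x = f2 y -> x = y].
Proof.
move=> sS Sm; have [L [f [lf fi fS]]] := sub_lmodP sS.
pose mode v n (x : L) : L := xget 0 [set y | f y = (tw_mode v n (f x).1, tw_mode v n (f x).2)].
have fm v n x : f (mode v n x) = (tw_mode v n (f x).1, tw_mode v n (f x).2).
  rewrite /mode; case: xgetP => [y _ //|].
  have /fS[y fy] : S (tw_mode v n (f x).1, tw_mode v n (f x).2).
    by apply: Sm; apply/fS; exists x.
  by move=> /(_ y).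
pose f1 x := (f x).1; pose f2 x := (f x).2.
have lf1 : linear f1 by move=> a x y; rewrite /f1 lf.
have lf2 : linear f2 by move=> a x y; rewrite /f2 lf.
have fm1 v n x : f1 (mode v n x) = tw_mode v n (f1 x) by rewrite /f1 fm.
have fm2 v n x : f2 (mode v n x) = tw_mode v n (f2 x) by rewrite /f2 fm.
have f12 x y : f1 x = f1 y -> f2 x = f2 y -> x = y.
  by move=> e1 e2; apply: fi; apply: injective_projections.
have fE y : (f1 y, f2 y) = f y by rewrite /f1 /f2 -surjective_pairing.
exists (tw_of_axioms (tw_axioms_embed lf1 lf2 fm1 fm2 f12)), f1, f2; split=> // x.
by split=> [/fS[y <-]|[y <-]]; [exists y|apply/fS; exists y].
Qed.

Lemma tw_sub (Q : twisted_module g) (S : set Q) : tw_submodule S ->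
  exists (U : twisted_module g) (f : U -> Q),
    [/\ tw_hom f, injective f & forall x, S x <-> exists y, f y = x].
Proof.
move=> [sS Sm]; pose D := [set x : (Q * Q)%type | S x.1 /\ x.1 = x.2].
have [||U [f1 [f2 [h1 h2 DP f12]]]] := @tw_sub_prod Q Q D.
- split; first by split=> //; exact: subspace0.
  move=> a [x1 x2] [y1 y2] [/= Sx <-] [/= Sy <-]; split=> //=.
  by apply: (proj2 sS).
- by move=> v n [x1 x2] [/= Sx <-]; split=> //=; apply: Sm.
have e x : f1 x = f2 x by have [] : D (f1 x, f2 x) by apply/DP; exists x.
exists U, f1; split=> // [x y xy|x]; first by apply: f12; rewrite -?e.
split=> [Sx|[y <-]]; last by have [] : D (f1 y, f2 y) by apply/DP; exists y.
by have /DP[y [yx _]] : D (x, x) by []; exists y.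
Qed.

Lemma tw_quot (U : twisted_module g) (S : set U) : tw_submodule S ->
  exists (Q : twisted_module g) (f : U -> Q),
    [/\ tw_hom f, forall y, exists x, f x = y & forall x, f x = 0 <-> S x].
Proof.
move=> [sS Sm]; have [L [f [lf fs fS]]] := quot_lmodP sS.
have [h hK] : {h : L -> U & cancel h f} by apply: (choice fs).
pose mode v n (x : L) : L := f (tw_mode v n (h x)).
have fm v n x : f (tw_mode v n x) = mode v n (f x).
  apply/eqP; rewrite -subr_eq0 -(linB lf) -(linB (tw_mode_linearr _ _)); apply/eqP/fS.
  by apply: Sm; apply/fS; rewrite (linB lf) hK subrr.
exists (tw_of_axioms (tw_axioms_quot lf fs fm)), f; split=> //.
Qed.

End SubQuotient.

(** * Weights *)

Section Cbinom.
Variable R : realType.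
Implicit Types s : R[i].

Lemma cbinom0 s : cbinom s 0 = 1.
Proof. by rewrite /cbinom big_ord0 fact0 divr1. Qed.

Lemma cbinom1 s : cbinom s 1 = s.
Proof. by rewrite /cbinom big_ord1 subr0 divr1. Qed.

Lemma cbinom_nat_small (n i : nat) : (n < i)%N -> cbinom (n%:R : R[i]) i = 0.
Proof.
move=> ni; rewrite /cbinom (bigD1 (Ordinal ni)) //= subrr mul0r mul0r.
by [].
Qed.

End Cbinom.

Lemma big_nat_first (M : nmodType) (F : nat -> M) N : (0 < N)%N ->
  (forall i, (0 < i)%N -> F i = 0) -> \sum_(0 <= i < N) F i = F 0%N.
Proof.
by case: N => // N _ F0; rewrite big_nat_recl // big1 ?addr0 // => i _; rewrite F0.
Qed.

Lemma big_nat_first2 (M : nmodType) (F : nat -> M) N : (1 < N)%N ->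
  (forall i, (1 < i)%N -> F i = 0) -> \sum_(0 <= i < N) F i = F 0%N + F 1%N.
Proof.
case: N => [|N] // N0 F0; rewrite big_nat_recl //; congr (_ + _).
by apply: (big_nat_first (F := fun i => F i.+1)) => // i i0; rewrite F0.
Qed.

Section RootFrac.
Variables (R : realType) (V : voa R).

Definition coset (g : fin_aut V) (r : nat) : R[i] := (root_frac R r (aut_order g))%:C.

Lemma coset0 (g : fin_aut V) : coset g 0 = 0.
Proof. by rewrite /coset /root_frac mul0r. Qed.

Lemma cosetE (g : fin_aut V) r : coset g r = r%:R / (aut_order g)%:R.
Proof. by rewrite /coset /root_frac fmorph_div !rmorph_nat. Qed.

End RootFrac.

Section ModuleWeights.
Variables (R : realType) (V : voa R) (g : fin_aut V) (W : twisted_module g).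
Implicit Types (u v : V) (w : W).

Lemma tw_jac r v u w (l m : int) q : (r < aut_order g)%N -> aut_eig g r v ->
  exists N0 : nat, forall N, (N0 <= N)%N ->
  let p := m%:~R - coset g r in
  jac_left (@tw_mode _ _ _ W) v u w l p q N - jac_right (@tw_mode _ _ _ W) v u w l p q N
  = jac_iter (@tw_mode _ _ _ W) v u w l p q N.
Proof. exact: (ta_jacobi (tw_module_axioms W)). Qed.

Lemma tw_mode0 v n : tw_mode v n (0 : W) = 0.
Proof. exact: lin0 (tw_mode_linearr _ _). Qed.

Lemma tw_0mode n w : tw_mode 0 n w = 0.
Proof. exact: (lin0 (tw_mode_linearl n w)). Qed.

(* The Jacobi identity of [v] with the vacuum, since [L(-1) v = v_(-2) 1]. *)
Lemma tw_Lm v n w : tw_mode (voa_Lm v) n w = - n *: tw_mode v (n - 1) w.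
Proof.
pose B := [set v | forall n w, tw_mode (voa_Lm v) n w = - n *: tw_mode v (n - 1) (w : W)].
have sB : subspace B.
  split=> [n' w'|a x y Bx By n' w'].
    by rewrite /voa_Lm (lin0 (voa_mode_linearr _ _)) !tw_0mode scaler0.
  rewrite /voa_Lm (voa_mode_linearr (voa_omega V) 0) !tw_mode_linearl -/(voa_Lm _).
  by rewrite Bx -/(voa_Lm _) By scalerDr !scalerA mulrC.
suff : B v by apply.
have [f [-> fP]] := @aut_decomp _ _ g setT v (conj I (fun _ _ _ _ _ => I))
  (fun _ _ => I) I.
apply: (subspace_sum sB) => -[r rT] _ _ /= {n w} n w; have [_ fr] := fP r.
have [[k nk]|nk] := pselect (exists k : int, n = k%:~R - coset g r); last first.
  rewrite !(tw_grading _ rT) ?scaler0 //.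
  - move=> k; apply/eqP => e; apply: nk; exists (k + 1).
    by rewrite intrD addrAC -[LHS](subrK 1) e.
  - exact: aut_eig_Lm.
  - by move=> k; apply/eqP => e; apply: nk; exists k.
(* With [l = -2] and [q = 0] the vacuum mode $-1$ never occurs in the two products, so both vanish.
   In the iterate, [i >= 2] meets nonnegative modes on the vacuum; only [i = 0] and [i = 1] survive,
   and the truncation at least 2 keeps both. *)
have [N /(_ (maxn N 2) (leq_maxl _ _)) /=] := tw_jac (voa_vac V) w (-2) k 0 rT fr.
rewrite -nk /jac_left big1 => [|i _]; last first.
  rewrite tw_vacuum add0r ifF ?tw_mode0 ?scaler0 //.
  by apply/negbTE; rewrite -addr_eq0 natr1 pnatr_eq0.
rewrite /jac_right big1 => [|i _]; last first.
  rewrite tw_vacuum ifF ?scaler0 //; apply/negbTE.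
  rewrite add0r -subr_eq0 opprK -[(-2)%:~R]/(- 2%:R) addrAC.
  rewrite (_ : - 2%:R + 1 = -1); last by ring.
  by rewrite -opprD oppr_eq0 nat1r pnatr_eq0.
have N2 : (1 < maxn N 2)%N by rewrite leq_max leqnn orbT.
rewrite subr0 /jac_iter (big_nat_first2 N2) => [|i i1]; last first.
  have [_ h] := voa_creation (f r).
  by rewrite h ?tw_0mode ?scaler0 //; lia.
rewrite cbinom0 scale1r cbinom1 -voa_LmE (_ : -2 + 1 = -1)%R //.
have [-> _] := voa_creation (f r); rewrite !addr0 !subr0 => /eqP.
by rewrite eq_sym addr_eq0 scaleNr => /eqP.
Qed.

Lemma tw_L0_linear : linear (@tw_L _ _ _ W 0).
Proof. exact: tw_mode_linearr. Qed.

Lemma tw_L0E w : tw_L 0 w = tw_mode (voa_omega V) 1 w.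
Proof. by rewrite /tw_L add0r. Qed.

(** The Jacobi identity of $\omega$ with [l = 0] and [p = 1] is the commutator formula
    $[L(0),u_q]=(L(-1)u)_{q+1}+(L(0)u)_q$; [tw_Lm] evaluates the first term. *)
Lemma tw_L0_comm d u q w : voa_grade d u ->
  tw_L 0 (tw_mode u q w) - tw_mode u q (tw_L 0 w)
  = (d%:~R - q - 1) *: tw_mode u q w.
Proof.
move=> du; have [N] := tw_jac u w 0 1 q (aut_order_gt0 g) (aut_eig_omega g).
move=> /(_ (maxn N 2) (leq_maxl _ _)) /=; rewrite coset0 subr0.
have N2 : (1 < maxn N 2)%N by rewrite leq_max leqnn orbT.
have c0 i : (0 < i)%N -> cbinom (0%:~R : R[i]) i = 0.
  exact: (@cbinom_nat_small R 0).
rewrite /jac_left (big_nat_first (ltnW N2)) => [|i i0]; last first.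
  by rewrite c0 // mulr0 scale0r.
rewrite /jac_right (big_nat_first (ltnW N2)) => [|i i0]; last first.
  by rewrite c0 // mulr0 scale0r.
rewrite /jac_iter (big_nat_first2 N2) => [|i i0]; last first.
  by rewrite (@cbinom_nat_small R 1) // scale0r.
rewrite !cbinom0 cbinom1 !expr0 !mulr1 !scale1r !addr0 !subr0 !add0r.
rewrite -[voa_mode _ 0 u]/(voa_Lm u) tw_Lm (voa_L0 du) (linZ (tw_mode_linearl _ _)).
rewrite !tw_L0E mulr1z (addrC 1 q) addrK -scalerDl => ->.
by congr (_ *: _); ring.
Qed.

Lemma gen_eig_subspace l : subspace (@gen_eig _ _ _ W l).
Proof. exact: geig_subspace tw_L0_linear l. Qed.

Lemma tw_mode_weight d u q w l : voa_grade d u -> gen_eig l w ->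
  gen_eig (l + d%:~R - q - 1) (tw_mode u q w).
Proof.
move=> du [k wk]; exists k.
have C x : shift (@tw_L _ _ _ W 0) (l + d%:~R - q - 1) (tw_mode u q x)
    = tw_mode u q (shift (@tw_L _ _ _ W 0) l x).
  rewrite /shift (linB (tw_mode_linearr _ _)) (linZ (tw_mode_linearr _ _)).
  have /eqP := tw_L0_comm q x du; rewrite subr_eq => /eqP ->.
  rewrite addrAC addrC -addrA; congr (_ + _).
  by rewrite -scalerBl -scaleNr; congr (_ *: _); ring.
have CK j : iter j (shift (@tw_L _ _ _ W 0) (l + d%:~R - q - 1)) (tw_mode u q w)
    = tw_mode u q (iter j (shift (@tw_L _ _ _ W 0) l) w).
  by elim: j => //= j ->; rewrite C.
by have := CK k; rewrite [iter k _ w]wk tw_mode0.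
Qed.

(** Here [v'] is $L(-1)^jv$: each use of $(L(-1)v)_n=-n\,v_{n-1}$ raises the mode by one, and the
    factor is invertible because the indices $-1-r/T-j$ are negative. *)
Lemma tw_mode_lower (r j : nat) d v : aut_eig g r v -> voa_grade d v ->
  exists (v' : V) (c : R[i]), [/\ aut_eig g r v', voa_grade (d + j%:Z) v' &
    forall w, tw_mode v (- 1 - coset g r - j%:R) w = c *: tw_mode v' (- 1 - coset g r) w].
Proof.
elim: j d v => [|j IH] d v vr vd.
  by exists v, 1; split=> [//||w]; rewrite ?addr0 // subr0 scale1r.
have [v' [c [v'r v'd h]]] := IH _ _ (aut_eig_Lm vr) (voa_Lm_grade vd).
set n := - 1 - coset g r in h *.
have n0 : - (n - j%:R) != 0.
  rewrite /n opprD !opprK opprD !opprK cosetE.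
  apply: lt0r_neq0; rewrite -!addrA ltr_pwDl ?ltr01 // addr_ge0 ?ler0n //.
  by rewrite divr_ge0 ?ler0n.
exists v', ((- (n - j%:R))^-1 * c); split=> // [|w].
  by rewrite (_ : d + _ = d + 1 + j%:Z) //; lia.
rewrite -scalerA -h tw_Lm scalerA mulVf // scale1r; congr tw_mode.
by rewrite -natr1; ring.
Qed.

End ModuleWeights.

(** * Intertwining operators *)

Section IntertwiningSums.
Variables (R : realType) (V : voa R) (g1 g2 g3 : fin_aut V).
Variables (W1 : twisted_module g1) (W2 : twisted_module g2) (W3 : twisted_module g3).
Variable Y : W1 -> R[i] -> nat -> W2 -> W3.

Definition io_left (v : V) w1 w2 (s : R) (p q : R[i]) k N : W3 :=
  \sum_(0 <= i < N) ((-1) ^+ i * cbinom s%:C i) *: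
    tw_mode v (p + s%:C - i%:R) (Y w1 (q + i%:R) k w2).

Definition io_right (v : V) w1 w2 (s : R) (p q : R[i]) k N : W3 :=
  \sum_(0 <= i < N) (cis (pi * (s - i%:R)) * cbinom s%:C i) *:
    Y w1 (q + s%:C - i%:R) k (tw_mode v (p + i%:R) w2).

Definition io_iter (v : V) w1 w2 (s : R) (p q : R[i]) k N : W3 :=
  \sum_(0 <= i < N) cbinom p i *:
    Y (tw_mode v (s%:C + i%:R) w1) (p + q - i%:R) k w2.

Lemma io_fsum : (forall n k w2, linear (fun w1 => Y w1 n k w2)) ->
  (forall w1 n k, linear (Y w1 n k)) ->
  (forall w1 w2 (h : R[i]), exists N : nat,
    forall n k, (N <= n)%N -> Y w1 (h + n%:R) k w2 = 0) ->
  forall (v : V) w1 w2 (s : R) (p q : R[i]) k,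
  exists N0 : nat, forall N, (N0 <= N)%N ->
  [/\ \sum_(i \in [set: nat]) ((-1) ^+ i * cbinom s%:C i) *:
        tw_mode v (p + s%:C - i%:R) (Y w1 (q + i%:R) k w2) = io_left v w1 w2 s p q k N,
      \sum_(i \in [set: nat]) (cis (pi * (s - i%:R)) * cbinom s%:C i) *:
        Y w1 (q + s%:C - i%:R) k (tw_mode v (p + i%:R) w2) = io_right v w1 w2 s p q k N
    & \sum_(i \in [set: nat]) cbinom p i *:
        Y (tw_mode v (s%:C + i%:R) w1) (p + q - i%:R) k w2 = io_iter v w1 w2 s p q k N].
Proof.
move=> Yl Yr Yt v w1 w2 s p q k.
have [N1 h1] := Yt w1 w2 q; have [N2 h2] := tw_trunc v p w2.
have [N3 h3] := tw_trunc v s%:C w1.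
exists (maxn (maxn N1 N2) N3) => N; rewrite !geq_max => /andP[/andP[N1N N2N] N3N].
split; apply: fsum_nat => i Ni.
- by rewrite h1 ?(leq_trans _ Ni) // tw_mode0 scaler0.
- by rewrite h2 ?(leq_trans _ Ni) // (lin0 (Yr _ _ _)) scaler0.
- by rewrite h3 ?(leq_trans _ Ni) // (lin0 (Yl _ _ _)) scaler0.
Qed.

Section Consequences.
Hypothesis hY : intertwining Y.

Lemma io_0l n k w2 : Y 0 n k w2 = 0.
Proof. exact: (lin0 (io_linearl hY n k w2)). Qed.

Lemma io_0r w1 n k : Y w1 n k 0 = 0.
Proof. exact: (lin0 (io_linearr hY w1 n k)). Qed.

Lemma io_jac r1 r2 v w1 w2 (l m : int) (q : R[i]) k :
  (r1 < aut_order g1)%N -> (r2 < aut_order g2)%N ->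
  aut_eig g1 r1 v -> aut_eig g2 r2 v ->
  let s := l%:~R - root_frac R r1 (aut_order g1) in
  let p := m%:~R - coset g2 r2 in
  exists N0 : nat, forall N, (N0 <= N)%N ->
    io_left v w1 w2 s p q k N - io_right v w1 w2 s p q k N = io_iter v w1 w2 s p q k N.
Proof.
move=> r1T r2T e1 e2 s p.
have [N0 h] := io_fsum (io_linearl hY) (io_linearr hY) (io_truncation hY) v w1 w2 s p q k.
by exists N0 => N /h[<- <- <-]; exact: (io_jacobi hY).
Qed.

(** Again the commutator formula of $\omega$. The $L(-1)$-derivative property turns
    $(L(-1)w^1)_{q+1}$ into the last two terms, the derivative of the logarithm contributing the
    exponent [k.+1]. *)
Lemma io_L0 w1 q k w2 :
  tw_L 0 (Y w1 q k w2) = Y (tw_L 0 w1) q k w2 + Y w1 q k (tw_L 0 w2)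
    - (q + 1) *: Y w1 q k w2 + k.+1%:R *: Y w1 q k.+1 w2.
Proof.
have [N] := io_jac w1 w2 0 1 q k (aut_order_gt0 g1) (aut_order_gt0 g2)
  (aut_eig_omega g1) (aut_eig_omega g2).
move=> /(_ (maxn N 2) (leq_maxl _ _)).
have N2 : (1 < maxn N 2)%N by rewrite leq_max leqnn orbT.
rewrite coset0 subr0 {1 2 3}/root_frac mul0r subr0.
have c0 i : (0 < i)%N -> cbinom (0%:~R : R)%:C i = 0.
  exact: (@cbinom_nat_small R 0).
rewrite /io_left (big_nat_first (ltnW N2)) => [|i i0]; last by rewrite c0 // mulr0 scale0r.
rewrite /io_right (big_nat_first (ltnW N2)) => [|i i0]; last by rewrite c0 // mulr0 scale0r.
rewrite /io_iter (big_nat_first2 N2) => [|i i0]; last first.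
  by rewrite (@cbinom_nat_small R 1) // scale0r.
rewrite !cbinom0 cbinom1 !mulr0z !subr0 mulr0 cis0 !mulr1 !scale1r !rmorph0.
rewrite !addr0 !add0r !mulr1z -!tw_L0E => /eqP.
have Lm1 : tw_mode (voa_omega V) 0 w1 = tw_L (-1) w1.
  by rewrite /tw_L -[(-1)%:~R]/(-1) addNr.
rewrite subr_eq Lm1 (io_Lm1 hY) (addrC 1 q) addrK => /eqP ->.
by rewrite scaleNr -addrA addrC addrA.
Qed.

Lemma io_shift a b q k w1 w2 :
  shift (@tw_L _ _ _ W3 0) (a + b - q - 1) (Y w1 q k w2)
  = Y (shift (@tw_L _ _ _ W1 0) a w1) q k w2 + Y w1 q k (shift (@tw_L _ _ _ W2 0) b w2)
    + k.+1%:R *: Y w1 q k.+1 w2.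
Proof.
rewrite /shift io_L0 (linB (io_linearl hY _ _ _)) (linZ (io_linearl hY _ _ _)).
rewrite (linB (io_linearr hY _ _ _)) (linZ (io_linearr hY _ _ _)).
have -> : a + b - q - 1 = a + b - (q + 1) by ring.
rewrite scalerBl (scalerDl _ a b) addrACA -opprD.
by rewrite opprB addrA (addrAC _ (k.+1%:R *: _)) subrK [LHS]addrAC.
Qed.

(** By [io_shift] one shift yields three terms: the nilpotency exponent of [w1] or of [w2] drops, or
    the logarithmic exponent grows towards the bound of [io_log]. Hence three nested inductions. *)
Lemma io_weight a b q k w1 w2 : gen_eig a w1 -> gen_eig b w2 ->
  gen_eig (a + b - q - 1) (Y w1 q k w2).
Proof.
move=> [n]; elim: n w1 w2 k => [|n IHn] w1 w2 k.
  by move=> /= -> _; rewrite io_0l; exact: subspace0 (gen_eig_subspace _ _).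
rewrite iterSr => w1n [j]; elim: j w2 k => [|j IHj] w2 k.
  by move=> /= ->; rewrite io_0r; exact: subspace0 (gen_eig_subspace _ _).
rewrite iterSr => w2j.
have [K YK] := io_log hY w1 q w2.
have [d] : exists d, (K - k <= d)%N by exists (K - k)%N.
elim: d k => [|d IHd] k Kk.
  by rewrite YK; [exact: subspace0 (gen_eig_subspace _ _)|rewrite -subn_eq0 -leqn0].
apply: shift_geig; rewrite io_shift.
apply: (subspaceD (gen_eig_subspace _ _)); last first.
  by apply: (subspaceZ (gen_eig_subspace _ _)); apply: IHd; lia.
apply: (subspaceD (gen_eig_subspace _ _)).
  by apply: IHn => //; exists j.+1; rewrite iterSr.
exact: IHj.
Qed.

End Consequences.

End IntertwiningSums.

Section IntertwiningImage.
Variables (R : realType) (V : voa R) (g1 g2 g3 : fin_aut V).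
Hypothesis g12 : forall v, g1 (g2 v) = g2 (g1 v).
Hypothesis g3E : forall v, g3 v = g1 (g2 v).
Variables (W1 : twisted_module g1) (W2 : twisted_module g2) (W3 : twisted_module g3).
Variable Y : W1 -> R[i] -> nat -> W2 -> W3.
Hypothesis hY : intertwining Y.

Lemma coset_prod r1 r2 v : (r1 < aut_order g1)%N -> (r2 < aut_order g2)%N ->
  joint_eig g1 g2 r1 r2 v -> v != 0 ->
  exists r3 (e : bool), [/\ (r3 < aut_order g3)%N, aut_eig g3 r3 v &
    coset g1 r1 + coset g2 r2 = coset g3 r3 + e%:R].
Proof.
move=> r1T r2T [e1 e2] v0.
have [r3 [e [r3T e3 E]]] := aut_eig_prod g3E r1T r2T e1 e2 v0.
exists r3, e; split=> //; rewrite /coset -rmorphD E rmorphD; congr (_ + _).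
by rewrite rmorph_nat.
Qed.

Lemma coset_real (s : int) r : (s%:~R - root_frac R r (aut_order g1))%:C
  = s%:~R - coset g1 r :> R[i].
Proof. by rewrite rmorphB /= rmorph_int. Qed.

Definition io_image : set W3 := span [set x : W3 | exists w1 n k w2, x = Y w1 n k w2].

(* Downward induction on the first mode: the leading term of the Jacobi identity
   is [v] acting on a coefficient of [Y], all other terms being coefficients of
   [Y] or [v] acting on higher coefficients. *)
Lemma io_image_submodule : tw_submodule io_image.
Proof.
have sI : subspace io_image := span_subspace _.
have YI w1 n k w2 : io_image (Y w1 n k w2) by apply: sub_span; exists w1, n, k, w2.
split=> // v n w Iw.
pose B := [set v | forall n w, io_image w -> io_image (tw_mode v n w)].
have sB : subspace B.
  split=> [n' w' _|a x y Bx By n' w' Iw']; first by rewrite tw_0mode; exact: subspace0.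
  by rewrite (tw_mode_linearl n' w'); apply: (proj2 sI); [apply: Bx|apply: By].
suff : B v by apply.
apply: (@joint_decomp _ _ g1 g2 g12 B setT) => // {v n w Iw} r1 r2 v r1T r2T _ ev n w Iw.
apply: (span_sub (B := tw_mode v n @^-1` io_image)) Iw.
  by apply: subspace_preim => //; exact: tw_mode_linearr.
move=> _ [w1 [q [k [w2 ->]]]] /=.
have [v0|v0] := eqVneq v 0; first by rewrite v0 tw_0mode; exact: subspace0.
have [r3 [e [r3T e3 E]]] := coset_prod r1T r2T ev v0.
have [N hN] := io_truncation hY w1 w2 q.
have {hN} : forall j, (N <= j)%N -> Y w1 (q + j%:R) k w2 = 0 by move=> j; apply: hN.
elim: N q n => [|N IH] q n hN.
  by move: (hN 0%N isT); rewrite addr0 => ->; rewrite tw_mode0; exact: subspace0.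
have [[l nl]|nl] := pselect (exists l : int, n = l%:~R - coset g3 r3); last first.
  rewrite (tw_grading _ r3T e3); first exact: subspace0.
  by move=> l; apply/eqP => nE; apply: nl; exists l.
(* Adding the carry [e] to [l] makes $p+s=l+e-r_1/T_1-r_2/T_2=l-r_3/T_3$, so the leading term is
   exactly the mode [n] of [v]. *)
have [M] := io_jac hY w1 w2 (l + e) 0 q k r1T r2T ev.1 ev.2.
set s := _ - root_frac _ _ _ => /(_ M.+1 (leqnSn _)).
have ps : 0%:~R - coset g2 r2 + s%:C = n.
  rewrite /s coset_real nl -[coset g3 r3](addrK e%:R) -E intrD; ring.
have IR : io_image (io_right Y v w1 w2 s (0%:~R - coset g2 r2) q k M.+1).
  by apply: (subspace_sum sI) => i _ _; apply: (subspaceZ sI).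
have II : io_image (io_iter Y v w1 w2 s (0%:~R - coset g2 r2) q k M.+1).
  by apply: (subspace_sum sI) => i _ _; apply: (subspaceZ sI).
rewrite /io_left big_nat_recl // ps cbinom0 mulr1 expr0 scale1r subr0 addr0.
set Z := \sum_(0 <= i < M) _.
have IZ : io_image Z.
  apply: (subspace_sum sI) => i _ _; apply: (subspaceZ sI).
  apply: IH => j Nj; rewrite -addrA -natrD; apply: hN.
  by rewrite addSn ltnS (leq_trans Nj) // leq_addl.
move/eqP; rewrite subr_eq => /eqP eZ.
have -> : tw_mode v n (Y w1 q k w2) = io_iter Y v w1 w2 s (0%:~R - coset g2 r2) q k M.+1
    + io_right Y v w1 w2 s (0%:~R - coset g2 r2) q k M.+1 - Z.
  by rewrite -eZ addrK.
by apply: (subspaceB sI) => //; apply: (subspaceD sI).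
Qed.

End IntertwiningImage.

Section IntertwiningEmbed.
Variables (R : realType) (V : voa R) (g1 g2 g3 : fin_aut V).
Variables (W1 : twisted_module g1) (W2 : twisted_module g2).

Lemma io_map (M N : twisted_module g3) (Y : W1 -> R[i] -> nat -> W2 -> M)
    (Y' : W1 -> R[i] -> nat -> W2 -> N) (f : M -> N) :
  linear f -> (forall v n w, f (tw_mode v n w) = tw_mode v n (f w)) ->
  (forall w1 n k w2, f (Y w1 n k w2) = Y' w1 n k w2) ->
  forall v w1 w2 s p q k L,
  [/\ f (io_left Y v w1 w2 s p q k L) = io_left Y' v w1 w2 s p q k L,
      f (io_right Y v w1 w2 s p q k L) = io_right Y' v w1 w2 s p q k L
    & f (io_iter Y v w1 w2 s p q k L) = io_iter Y' v w1 w2 s p q k L].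
Proof.
move=> lf fm fY v w1 w2 s p q k L; split;
  rewrite /io_left /io_right /io_iter lin_sum //; apply: eq_bigr => i _;
  by rewrite linZ // ?fm fY.
Qed.

Variables (U P W : twisted_module g3).
Variables (Y : W1 -> R[i] -> nat -> W2 -> U).
Variables (YP : W1 -> R[i] -> nat -> W2 -> P) (YW : W1 -> R[i] -> nat -> W2 -> W).
Hypotheses (hP : intertwining YP) (hW : intertwining YW).
Variables (f1 : U -> P) (f2 : U -> W).
Hypotheses (hf1 : tw_hom f1) (hf2 : tw_hom f2).
Hypothesis f12 : forall x y, f1 x = f1 y -> f2 x = f2 y -> x = y.
Hypothesis Y1 : forall w1 n k w2, f1 (Y w1 n k w2) = YP w1 n k w2.
Hypothesis Y2 : forall w1 n k w2, f2 (Y w1 n k w2) = YW w1 n k w2.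

Let lf1 : linear f1 := proj1 hf1.
Let lf2 : linear f2 := proj1 hf2.

(** As for modules, every clause is an identity or a vanishing statement, detected by the jointly
    injective pair [f1], [f2]. *)
Lemma intertwining_embed : intertwining Y.
Proof.
have z w1 n k w2 : YP w1 n k w2 = 0 -> YW w1 n k w2 = 0 -> Y w1 n k w2 = 0.
  by move=> e1 e2; apply: f12; rewrite ?Y1 ?Y2 ?e1 ?e2 lin0.
have Yl n k w2 : linear (fun w1 => Y w1 n k w2).
  move=> a x y; apply: f12; rewrite ?lf1 ?lf2 ?Y1 ?Y2.
    exact: (io_linearl hP n k w2).
  exact: (io_linearl hW n k w2).
have Yr w1 n k : linear (Y w1 n k).
  move=> a x y; apply: f12; rewrite ?lf1 ?lf2 ?Y1 ?Y2.
    exact: (io_linearr hP w1 n k).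
  exact: (io_linearr hW w1 n k).
have Yt w1 w2 (h : R[i]) : exists N : nat,
    forall n k, (N <= n)%N -> Y w1 (h + n%:R) k w2 = 0.
  have [N1 h1] := io_truncation hP w1 w2 h; have [N2 h2] := io_truncation hW w1 w2 h.
  exists (maxn N1 N2) => n k; rewrite geq_max => /andP[n1 n2].
  by apply: z; [exact: h1|exact: h2].
split=> //.
- move=> w1 n w2; have [K1 h1] := io_log hP w1 n w2; have [K2 h2] := io_log hW w1 n w2.
  exists (maxn K1 K2) => k; rewrite geq_max => /andP[k1 k2].
  by apply: z; [exact: h1|exact: h2].
- move=> r1 r2 v w1 w2 l m q k r1T r2T e1 e2 s p.
  have [N h] := io_fsum Yl Yr Yt v w1 w2 s p q k.
  have [N1 h1] := io_jac hP w1 w2 l m q k r1T r2T e1 e2.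
  have [N2 h2] := io_jac hW w1 w2 l m q k r1T r2T e1 e2.
  pose N' := maxn N (maxn N1 N2).
  have [-> -> ->] := h N' (leq_maxl _ _).
  have {}h1 := h1 N' (leq_trans (leq_maxl _ _) (leq_maxr _ _)).
  have {}h2 := h2 N' (leq_trans (leq_maxr _ _) (leq_maxr _ _)).
  have [a1 b1 c1] := io_map lf1 (proj2 hf1) Y1 v w1 w2 s p q k N'.
  have [a2 b2 c2] := io_map lf2 (proj2 hf2) Y2 v w1 w2 s p q k N'.
  by apply: f12; rewrite linB // ?a1 ?a2 ?b1 ?b2 ?c1 ?c2.
- move=> w1 n k w2; apply: f12.
    by rewrite (linD lf1) !(linZ lf1) !Y1 (io_Lm1 hP).
  by rewrite (linD lf2) !(linZ lf2) !Y2 (io_Lm1 hW).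
Qed.

End IntertwiningEmbed.

(** * Finiteness of weight spaces *)

Section C1Homogeneous.
Variables (R : realType) (V : voa R) (g : fin_aut V) (W : twisted_module g).

Definition c1_weight (r : nat) (d : int) : bool := if r == 0%N then 0 < d else 0 <= d.

(** The generators of [C1] of weight [l]: the mode $v_{-1-r/T}$ raises the weight by $d+r/T$, which
    dictates the weight of [w]. *)
Definition C1_hom (l : R[i]) : set W :=
  [set x | exists (r : nat) (d : int) (v : V) (w : W),
    [/\ (r < aut_order g)%N, aut_eig g r v, voa_grade d v, c1_weight r d
      & gen_eig (l - d%:~R - coset g r) w
        /\ x = tw_mode v (- 1 - coset g r) w]].

Definition at_weight (s : seq (R[i] * W)) (l : R[i]) : set W :=
  [set x | (l, x) \in s].

Lemma C1_hom_weight l : C1_hom l `<=` @gen_eig _ _ _ W l.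
Proof.
move=> _ [r [d [v [w [rT vr vd _ [wl ->]]]]]].
have := tw_mode_weight (- 1 - coset g r) vd wl.
by congr (gen_eig _ _); ring.
Qed.

(** Representatives of $W/C_1(W)$ are split into weight components and stored with their weights.
    With the homogeneous generators of [C1] they span [W], so by [geig_full] they span each weight
    space separately. *)
Lemma C1_cofinite_hom : generalized W -> C1_cofinite W ->
  exists s : seq (R[i] * W), (forall le, le \in s -> gen_eig le.1 le.2) /\
    forall l, @gen_eig _ _ _ W l = span (at_weight s l `|` C1_hom l).
Proof.
move=> [[_ sp _] _] [n [b bP]].
have hb i : exists t : seq (R[i] * W), (forall le, le \in t -> gen_eig le.1 le.2) /\
    span [set e | exists2 le, le \in t & le.2 = e] (b i).
  have [s [f [Gf sf]]] := span_bigcup_decomp (@gen_eig_subspace _ _ _ W)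
    (eq_ind_r (@^~ (b i)) I sp).
  exists [seq (l, f l) | l <- undup s]; split=> [_ /mapP[l _ ->]//|].
  rewrite (sf (undup s)) ?undup_uniq //; last by move=> l; rewrite mem_undup.
  apply: (subspace_sum (span_subspace _)) => l ls _; apply: sub_span.
  by exists (l, f l) => //; apply/mapP; exists l.
have [t tP] : {t : 'I_n -> seq (R[i] * W) & forall i,
    (forall le, le \in t i -> gen_eig le.1 le.2) /\
    span [set e | exists2 le, le \in t i & le.2 = e] (b i)}.
  exact: (choice hb).
pose s := flatten [seq t i | i <- enum 'I_n].
have sh le : le \in s -> gen_eig le.1 le.2.
  by move=> /flatten_mapP[i _]; apply: (tP i).1.
exists s; split=> // l; apply/esym.
pose G l := span (at_weight s l `|` C1_hom l); rewrite -/(G l).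
apply: (geig_full (@tw_L0_linear _ _ _ W) (G := G)) => [m|m|].
- exact: span_subspace.
- apply: span_sub; first exact: gen_eig_subspace.
  by move=> x [/sh//|]; exact: C1_hom_weight.
apply/seteqP; split=> // x _.
have sG : subspace (span (\bigcup_l G l)) := span_subspace _.
have [c] := bP x; set y := \sum_(i < n) _ => Cxy.
rewrite -(subrK y x); apply: (subspaceD sG); last first.
  apply: (subspace_sum sG) => i _ _; apply: (subspaceZ sG).
  apply: (span_sub sG) (tP i).2 => _ [[m e] mt <-]; apply: sub_span; exists m => //.
  apply: sub_span; left; rewrite /at_weight /=.
  by apply/flatten_mapP; exists i => //; rewrite mem_enum.
apply: (span_sub sG) Cxy => _ [r [d [v [w [rT vr vd dr ->]]]]].
have : span (\bigcup_l @gen_eig _ _ _ W l) w by rewrite sp.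
apply: (span_sub (B := tw_mode v (- 1 - coset g r) @^-1` span (\bigcup_l G l))).
  by apply: subspace_preim => //; exact: tw_mode_linearr.
move=> w' [m _ w'm]; apply: sub_span; exists (m + d%:~R + coset g r) => //.
apply: sub_span; right; exists r, d, v, w'; split=> //; split=> //.
by rewrite (_ : _ - _ - _ = m) //; ring.
Qed.

(** Positivity is asked of [d + j], the weight of the vector by which [tw_mode_lower] replaces
    [v]. *)
Lemma C1_hom_span_cosets (l : R[i]) (d : int) (v : V) (r j : nat) (w : W) :
  (r < aut_order g)%N -> aut_eig g r v -> voa_grade d v ->
  c1_weight r (d + j%:Z) -> gen_eig (l - d%:~R - coset g r - j%:R) w ->
  span (C1_hom l) (tw_mode v (- 1 - coset g r - j%:R) w).
Proof.
move=> rT vr vd cd wl; have [v' [c [v'r v'd ->]]] := tw_mode_lower W j vr vd.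
apply: (subspaceZ (span_subspace _)); apply: sub_span.
exists r, (d + j%:Z), v', w; split=> //; split=> //.
by rewrite (_ : _ - _ - _ = l - d%:~R - coset g r - j%:R) // intrD; ring.
Qed.

(** A generator with data [r], [d] comes from weight [l - (d T + r) / T], where [c1_weight] makes
    [d T + r] positive. Each pair contributes a bilinear image of two finite-dimensional spaces, and
    the lower bound on weights leaves finitely many pairs. *)
Lemma finspan_C1_hom (l : R[i]) : generalized W ->
  (forall j : nat, (0 < j)%N -> finspan (@gen_eig _ _ _ W (l - j%:R / (aut_order g)%:R))) ->
  finspan (C1_hom l).
Proof.
move=> [_ low] fj; have [N hN] := low l.
set T := aut_order g; have T0 : (0 < T)%N := aut_order_gt0 g.
pose F (rd : nat * nat) : set W := [set x | [/\ (rd.1 < T)%N, c1_weight rd.1 rd.2 &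
  exists (v : V) (w : W), [/\ voa_grade rd.2 v,
     gen_eig (l - (rd.2)%:R - coset g rd.1) w & x = tw_mode v (- 1 - coset g rd.1) w]]].
have fF rd : finspan (F rd).
  have [rT|rT] := boolP (rd.1 < T)%N; last first.
    by apply: finspan_sub (finspan_null _) => x [h _ _]; case/negP: rT.
  have [c|c] := boolP (c1_weight rd.1 rd.2); last first.
    by apply: finspan_sub (finspan_null _) => x [_ h _]; case/negP: c.
  apply: finspan_sub (finspan_bilin (f := fun v w => tw_mode v (- 1 - coset g rd.1) w)
    (A := @voa_grade _ V rd.2)
    (B := @gen_eig _ _ _ W (l - (rd.2)%:R - coset g rd.1)) _ _ _ _).
  - by move=> x [_ _ [v [w ?]]]; exists v, w.
  - by move=> y; exact: tw_mode_linearl.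
  - by move=> x; exact: tw_mode_linearr.
  - exact: fin_dim_finspan (voa_fin_dim _ _).
  have -> : l - (rd.2)%:R - coset g rd.1 = l - (rd.2 * T + rd.1)%:R / T%:R.
    by rewrite cosetE natrD natrM mulrDl mulfK ?aut_order_neq0 // opprD addrA.
  apply: fj; move: c; rewrite /c1_weight; case: eqP => [->|]; last by lia.
  by rewrite addn0 muln_gt0 T0 andbT.
(* For [d > |N|] the index [-(d T + r)] is below the bound [N], so [w = 0]; such generators fall
   into the zero part of the union. *)
apply: finspan_sub (finspan_setU (finspan_null _)
  (finspan_bigcup (r := [seq (r, d) | r <- iota 0 T, d <- iota 0 `|N|.+1]) (fun rd _ => fF rd))).
move=> _ [r [d [v [w [rT vr vd cd [wl ->]]]]]].
have d0 : 0 <= d by move: cd; rewrite /c1_weight; case: ifP => // _ /ltW.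
case: d d0 vd cd wl => // d _ vd cd wl.
have [dN|dN] := ltnP d `|N|.+1; last first.
  left; suff -> : w = 0 by rewrite tw_mode0.
  apply: (hN (- (d * T + r)%:Z)).
    have : (d <= d * T)%N by rewrite leq_pmulr.
    by lia.
  move: wl; congr (gen_eig _ _); rewrite mulrNz cosetE.
  rewrite -[(Posz (_ + _))%:~R]/((d * T + r)%:R) natrD natrM mulNr mulrDl.
  by rewrite mulfK ?aut_order_neq0 // opprD addrA.
right; exists (r, d); last by split=> //; exists v, w.
by apply: allpairs_f; rewrite mem_iota.
Qed.

End C1Homogeneous.

Section FusionFiniteness.
Variables (R : realType) (V : voa R) (g1 g2 g3 : fin_aut V).
Hypothesis g12 : forall v, g1 (g2 v) = g2 (g1 v).
Hypothesis g3E : forall v, g3 v = g1 (g2 v).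
Variables (W1 : twisted_module g1) (W2 : twisted_module g2) (U : twisted_module g3).
Variable Y : W1 -> R[i] -> nat -> W2 -> U.
Hypothesis hY : intertwining Y.

(** The mode equals $-1-r_3/T_3-(e+j)$, so [C1_hom_span_cosets] applies with shift [e + j]. The
    delicate case is [r3 = 0]: either [e = 1] supplies positivity, or [r1 = r2 = 0] and the
    hypothesis says that [d] is positive. *)
Lemma C1_hom_span_joint (l : R[i]) (d : int) (v : V) (r1 r2 j : nat) (x : U) :
  (r1 < aut_order g1)%N -> (r2 < aut_order g2)%N -> joint_eig g1 g2 r1 r2 v ->
  voa_grade d v -> c1_weight r1 d || c1_weight r2 d ->
  gen_eig (l - d%:~R - coset g1 r1 - coset g2 r2 - j%:R) x ->
  span (C1_hom l) (tw_mode v (- 1 - coset g1 r1 - coset g2 r2 - j%:R) x).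
Proof.
move=> r1T r2T ev vd cd xl.
have [v0|v0] := eqVneq v 0.
  by rewrite v0 tw_0mode; exact: subspace0 (span_subspace _).
have [r3 [e [r3T e3 E]]] := coset_prod g3E r1T r2T ev v0.
have d0 : 0 <= d.
  by move: cd; rewrite /c1_weight; do 2 case: ifP => _; move=> /orP[]; lia.
have -> : - 1 - coset g1 r1 - coset g2 r2 - j%:R = - 1 - coset g3 r3 - (e + j)%:R.
  by rewrite natrD -[coset g3 r3](addrK e%:R) -E; ring.
apply: C1_hom_span_cosets r3T e3 vd _ _; last first.
  move: xl; congr (gen_eig _ _).
  by rewrite natrD -[coset g3 r3](addrK e%:R) -E; ring.
rewrite /c1_weight; case: eqP => r30; last by lia.
case: e E => E; first by lia.
suff [r10 r20] : r1 = 0%N /\ r2 = 0%N.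
  by move: cd; rewrite r10 r20 /c1_weight /=; lia.
move: E; rewrite r30 coset0 addr0 !cosetE => /eqP.
rewrite paddr_eq0 ?divr_ge0 ?ler0n // !mulf_eq0 !invr_eq0 !pnatr_eq0.
rewrite !(gtn_eqF (aut_order_gt0 _)) !orbF.
by move=> /andP[/eqP -> /eqP ->].
Qed.

Section Reduction.
Variables (l : R[i]) (G : set U).
Hypotheses (sG : subspace G) (CG : C1_hom l `<=` G).

Let spanG x : span (C1_hom l) x -> G x.
Proof. exact: span_sub. Qed.

Variables (r1 r2 : nat) (d : int) (v : V).
Hypotheses (r1T : (r1 < aut_order g1)%N) (r2T : (r2 < aut_order g2)%N).
Hypotheses (ev : joint_eig g1 g2 r1 r2 v) (vd : voa_grade d v).

(* The indices of the Jacobi identity are chosen so that [v] acts on the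
   coefficients of [Y] by modes landing in [C_1(U)], while every other term has
   a strictly smaller total weight of its two arguments. *)
Lemma io_reduce_left a b w1 w2 k : c1_weight r1 d ->
  gen_eig (a - d%:~R - coset g1 r1) w1 -> gen_eig b w2 ->
  (forall i : nat, G (Y (tw_mode v (- coset g1 r1 + i%:R) w1)
     (a - 1 - i%:R + b - l - 1) k w2)) ->
  (forall i : nat, G (Y w1 (a + b - l - 2 - coset g1 r1 + coset g2 r2 - i%:R) k
     (tw_mode v (- coset g2 r2 + i%:R) w2))) ->
  G (Y (tw_mode v (- 1 - coset g1 r1) w1) (a + b - l - 1) k w2).
Proof.
move=> cd w1a w2b G1 G2; set n := a + b - l - 1.
have [M] := io_jac hY w1 w2 (-1) 0 (n + coset g2 r2) k r1T r2T ev.1 ev.2.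
set s := _ - root_frac _ _ _ => /(_ M.+1 (leqnSn _)).
have sE : s%:C = - 1 - coset g1 r1 by rewrite /s coset_real.
set p := 0%:~R - _; have pE : p = - coset g2 r2 by rewrite /p mulr0z sub0r.
have GL : G (io_left Y v w1 w2 s p (n + coset g2 r2) k M.+1).
  apply: (subspace_sum sG) => i _ _; apply: (subspaceZ sG); apply: spanG.
  have -> : p + s%:C - i%:R = - 1 - coset g1 r1 - coset g2 r2 - i%:R.
    by rewrite sE pE; ring.
  apply: (C1_hom_span_joint r1T r2T ev vd); first by rewrite cd.
  have := io_weight hY (n + coset g2 r2 + i%:R) k w1a w2b.
  by congr (gen_eig _ _); rewrite /n; ring.
have GR : G (io_right Y v w1 w2 s p (n + coset g2 r2) k M.+1).
  apply: (subspace_sum sG) => i _ _; apply: (subspaceZ sG).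
  have := G2 i; rewrite pE; congr (G (Y _ _ _ _)).
  by rewrite sE /n; ring.
rewrite /io_iter big_nat_recl // cbinom0 scale1r addr0 sE subr0.
set Z := \sum_(0 <= i < M) _.
have GZ : G Z.
  apply: (subspace_sum sG) => i _ _; apply: (subspaceZ sG).
  have := G1 i; congr (G (Y (tw_mode _ _ _) _ _ _)); rewrite -natr1 ?pE ?/n; ring.
have -> : p + (n + coset g2 r2) = n by rewrite pE addrC addrK.
move=> eZ.
by apply: (subspace_addr sG GZ); rewrite addrC -eZ; apply: (subspaceB sG).
Qed.

(** The mirror image, with $s=-r_1/T_1$ and $p=-1-r_2/T_2$. The wanted coefficient is the term
    [i = 0] of the second product and carries the invertible phase [cis (pi * s)]. *)
Lemma io_reduce_right a b w1 w2 k : c1_weight r2 d ->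
  gen_eig a w1 -> gen_eig (b - d%:~R - coset g2 r2) w2 ->
  (forall i : nat, G (Y w1 (a + b - l - 1 - 1 - i%:R) k
     (tw_mode v (- coset g2 r2 + i%:R) w2))) ->
  (forall i : nat, G (Y (tw_mode v (- coset g1 r1 + i%:R) w1)
     (a + b - l - 2 - coset g2 r2 + coset g1 r1 - i%:R) k w2)) ->
  G (Y w1 (a + b - l - 1) k (tw_mode v (- 1 - coset g2 r2) w2)).
Proof.
move=> cd w1a w2b G2 G1; set n := a + b - l - 1.
have [M] := io_jac hY w1 w2 0 (-1) (n + coset g1 r1) k r1T r2T ev.1 ev.2.
set s := _ - root_frac _ _ _ => /(_ M.+1 (leqnSn _)).
have sE : s%:C = - coset g1 r1 by rewrite /s coset_real mulr0z sub0r.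
set p := (-1)%:~R - _; have pE : p = - 1 - coset g2 r2 by [].
have GL : G (io_left Y v w1 w2 s p (n + coset g1 r1) k M.+1).
  apply: (subspace_sum sG) => i _ _; apply: (subspaceZ sG); apply: spanG.
  have -> : p + s%:C - i%:R = - 1 - coset g1 r1 - coset g2 r2 - i%:R.
    by rewrite sE pE; ring.
  apply: (C1_hom_span_joint r1T r2T ev vd); first by rewrite cd orbT.
  have := io_weight hY (n + coset g1 r1 + i%:R) k w1a w2b.
  by congr (gen_eig _ _); rewrite /n; ring.
have GI : G (io_iter Y v w1 w2 s p (n + coset g1 r1) k M.+1).
  apply: (subspace_sum sG) => i _ _; apply: (subspaceZ sG).
  have := G1 i; rewrite sE; congr (G (Y _ _ _ _)).
  by rewrite pE /n; ring.
rewrite /io_right big_nat_recl //; set Z := \sum_(0 <= i < M) _.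
have GZ : G Z.
  apply: (subspace_sum sG) => i _ _; apply: (subspaceZ sG).
  have := G2 i; rewrite sE pE; congr (G (Y _ _ _ (tw_mode _ _ _))); rewrite -natr1 ?/n; ring.
rewrite cbinom0 mulr1 !subr0 addr0 pE sE addrK => eZ.
have := subspaceZ sG (cis (pi * s))^-1 (subspaceB sG (subspaceB sG GL GI) GZ).
by rewrite -eZ subKr addrK scalerA mulVf ?cis_neq0 // scale1r.
Qed.

End Reduction.

Section Generation.
Variables (s1 : seq (R[i] * W1)) (s2 : seq (R[i] * W2)).
Hypotheses (gW1 : generalized W1) (gW2 : generalized W2).
Hypothesis gen1 : forall a, @gen_eig _ _ _ W1 a = span (at_weight s1 a `|` C1_hom a).
Hypothesis gen2 : forall b, @gen_eig _ _ _ W2 b = span (at_weight s2 b `|` C1_hom b).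

(** By [io_weight] the target weight [l] and the weights of the representatives determine the power
    of $x$; only the logarithmic exponent stays free, and it is bounded by [io_log]. *)
Definition io_gens (l : R[i]) : set U :=
  [set x | exists le1 le2 k, [/\ le1 \in s1, le2 \in s2
     & x = Y le1.2 (le1.1 + le2.1 - l - 1) k le2.2]].

(** Induction on [(n1 - A) * T2 + (n2 - B) * T1], which is $T_1T_2$ times the total weight above the
    lower bounds [A] and [B] of the two cosets. If it is negative, one argument lies below its bound
    and vanishes. Otherwise an argument in [C1] is traded for terms of smaller measure. *)
Lemma io_generated l a b w1 w2 k : gen_eig a w1 -> gen_eig b w2 ->
  span (io_gens l `|` C1_hom l) (Y w1 (a + b - l - 1) k w2).
Proof.
set G := span _; have sG : subspace G := span_subspace _.
have CG : C1_hom l `<=` G by move=> x Cx; apply: sub_span; right.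
move: w1 w2 k; have [A hA] := gW1.2 a; have [B hB] := gW2.2 b.
set T1 := aut_order g1 in hA; set T2 := aut_order g2 in hB.
have T1p : (0 < T1)%N := aut_order_gt0 g1; have T2p : (0 < T2)%N := aut_order_gt0 g2.
have T10 : T1%:R != 0 :> R[i] := aut_order_neq0 g1 _.
have T20 : T2%:R != 0 :> R[i] := aut_order_neq0 g2 _.
suff IH : forall (N : nat) (n1 n2 : int), (n1 - A) * T2 + (n2 - B) * T1 < N ->
    forall a' b', a' = a + n1%:~R / T1%:R -> b' = b + n2%:~R / T2%:R ->
    forall w1 w2 k, gen_eig a' w1 -> gen_eig b' w2 -> G (Y w1 (a' + b' - l - 1) k w2).
  pose m : int := (0 - A) * T2 + (0 - B) * T1.
  move=> w1 w2 k; apply: (IH (absz m).+1 0 0 _ a b); rewrite ?mul0r ?addr0 //.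
  by rewrite -/m; lia.
elim=> [|N IH] n1 n2 nN a' b' a'E b'E w1 w2 k w1a w2b.
  have [n1A|n1A] := ltP n1 A.
    rewrite (_ : w1 = 0) ?io_0l //; first exact: subspace0.
    by apply: (hA _ n1A); rewrite -a'E.
  rewrite (_ : w2 = 0) ?io_0r //; first exact: subspace0.
  have n2B : n2 < B by rewrite ltNge; apply/negP => n2B; nia.
  by apply: (hB _ n2B); rewrite -b'E.
have step (n1' n2' : int) (a'' b'' : R[i]) x1 x2 c : (n1' - A) * T2 + (n2' - B) * T1 <
    (n1 - A) * T2 + (n2 - B) * T1 -> a'' = a + n1'%:~R / T1%:R ->
    b'' = b + n2'%:~R / T2%:R -> gen_eig a'' x1 -> gen_eig b'' x2 ->
    c = a'' + b'' - l - 1 -> G (Y x1 c k x2).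
  by move=> lt Ea Eb x1a x2b ->; apply: (IH n1' n2') => //; lia.
move: w1a; rewrite gen1.
apply: (span_sub (B := (fun w => Y w (a' + b' - l - 1) k w2) @^-1` G)).
  by apply: subspace_preim => //; exact: io_linearl.
move=> {}w1 [w1s|[r1 [d [v [w [r1T vr1 vd cd [wa ->]]]]]]] /=; last first.
  pose S := @voa_grade _ V d `&` aut_eig g1 r1.
  pose D := [set v | G (Y (tw_mode v (- 1 - coset g1 r1) w) (a' + b' - l - 1) k w2)].
  apply: (@joint_decomp _ _ g1 g2 g12 D S) => //.
  - by apply: subspace_setI; [exact: voa_grade_subspace|exact: aut_eig_subspace].
  - by move=> x [xd x1]; split; [exact: aut_grade|exact: aut_eig_self].
  - by move=> x [xd x1]; split; [exact: aut_grade|exact: aut_eig_commute].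
  - apply: (subspace_preim (f := fun v => Y (tw_mode v _ w) _ k w2)) => //.
    by move=> c x y; rewrite (tw_mode_linearl _ w) (io_linearl hY).
  move=> _ r2 x _ r2T [xd x1] [_ x2].
  apply: (io_reduce_left sG CG r1T r2T (conj x1 x2) xd cd wa w2b) => j.
    apply: (step (n1 - j.+1%:Z * T1) n2 (a' - 1 - j%:R) b') => //.
    - by nia.
    - by rewrite a'E intrB intrM -[(Posz j.+1)%:~R]/(j.+1%:R) -natr1; field.
    - have := tw_mode_weight (- coset g1 r1 + j%:R) xd wa.
      by congr (gen_eig _ _); ring.
  (* The first argument loses $d+r_1/T_1$ and the second gains $d+r_2/T_2-j-1$. The total changes by
     $r_2/T_2-r_1/T_1-j-1$, negative because $r_2<T_2$. *)
  apply: (step (n1 - d * T1 - r1%:Z) (n2 + d * T2 + r2%:Z - j.+1%:Z * T2)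
    (a' - d%:~R - coset g1 r1) (b' + d%:~R + coset g2 r2 - j%:R - 1)) => //.
  - have : (r2 * T1 < T2 * T1)%N by rewrite ltn_pmul2r.
    by have := leq0n (j * T1 * T2); have := leq0n (r1 * T2); nia.
  - by rewrite a'E !intrB intrM cosetE; field.
  - rewrite b'E !intrB !intrD !intrM cosetE -[(Posz j.+1)%:~R]/(j.+1%:R) -natr1.
    by field.
  - have := tw_mode_weight (- coset g2 r2 + j%:R) xd w2b.
    by congr (gen_eig _ _); ring.
  - by ring.
(* The first argument is now a chosen representative and the second one is reduced. The new terms
   may spoil the first argument again, which the induction hypothesis allows, as it covers all
   homogeneous arguments. *)
have w1a : gen_eig a' w1 by rewrite gen1; apply: sub_span; left.
move: w2b; rewrite gen2.
apply: (span_sub (B := Y w1 (a' + b' - l - 1) k @^-1` G)).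
  by apply: subspace_preim => //; exact: io_linearr.
move=> {}w2 [w2s|[r2 [d [v [w [r2T vr2 vd cd [wb ->]]]]]]] /=.
  by apply: sub_span; left; exists (a', w1), (b', w2), k.
pose S := @voa_grade _ V d `&` aut_eig g2 r2.
pose D := [set v | G (Y w1 (a' + b' - l - 1) k (tw_mode v (- 1 - coset g2 r2) w))].
apply: (@joint_decomp _ _ g1 g2 g12 D S) => //.
- by apply: subspace_setI; [exact: voa_grade_subspace|exact: aut_eig_subspace].
- move=> x [xd x2]; split; first exact: aut_grade.
  by apply: aut_eig_commute x2 => y; rewrite g12.
- by move=> x [xd x2]; split; [exact: aut_grade|exact: aut_eig_self].
- apply: (subspace_preim (f := fun v => Y w1 _ k (tw_mode v _ w))) => //.
  by move=> c x y; rewrite (tw_mode_linearl _ w) (io_linearr hY).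
move=> r1 _ x r1T _ [xd x2] [x1 _].
apply: (io_reduce_right sG CG r1T r2T (conj x1 x2) xd cd w1a wb) => j.
  apply: (step n1 (n2 - j.+1%:Z * T2) a' (b' - 1 - j%:R)) => //.
  - by nia.
  - by rewrite b'E intrB intrM -[(Posz j.+1)%:~R]/(j.+1%:R) -natr1; field.
  - have := tw_mode_weight (- coset g2 r2 + j%:R) xd wb.
    by congr (gen_eig _ _); ring.
  - by ring.
apply: (step (n1 + d * T1 + r1%:Z - j.+1%:Z * T1) (n2 - d * T2 - r2%:Z)
  (a' + d%:~R + coset g1 r1 - j%:R - 1) (b' - d%:~R - coset g2 r2)) => //.
- have : (r1 * T2 < T1 * T2)%N by rewrite ltn_pmul2r.
  by have := leq0n (j * T1 * T2); have := leq0n (r2 * T1); nia.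
- rewrite a'E !intrB !intrD !intrM cosetE -[(Posz j.+1)%:~R]/(j.+1%:R) -natr1.
  by field.
- by rewrite b'E !intrB intrM cosetE; field.
- have := tw_mode_weight (- coset g1 r1 + j%:R) xd w1a.
  by congr (gen_eig _ _); ring.
- by ring.
Qed.

Lemma finspan_io_gens l : finspan (io_gens l).
Proof.
pose F (p : (R[i] * W1) * (R[i] * W2)) : set U :=
  [set x | exists k, x = Y p.1.2 (p.1.1 + p.2.1 - l - 1) k p.2.2].
have fF p : finspan (F p).
  have [K hK] := io_log hY p.1.2 (p.1.1 + p.2.1 - l - 1) p.2.2.
  exists [seq Y p.1.2 (p.1.1 + p.2.1 - l - 1) k p.2.2 | k <- iota 0 K] => _ [k ->].
  have [kK|kK] := ltnP k K; last by rewrite hK //; exact: subspace0 (span_subspace _).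
  apply: sub_span; apply/mapP; exists k => //; by rewrite mem_iota.
apply: finspan_sub (finspan_bigcup (r := [seq (x, y) | x <- s1, y <- s2]) (fun p _ => fF p)).
move=> _ [le1 [le2 [k [h1 h2 ->]]]]; exists (le1, le2); last by exists k.
exact: allpairs_f.
Qed.

End Generation.

Hypotheses (gW1 : generalized W1) (cW1 : C1_cofinite W1).
Hypotheses (gW2 : generalized W2) (cW2 : C1_cofinite W2).
Hypotheses (gU : generalized U) (sY : surjective_io Y).

(* Modulo [C_1(U)], a weight space of [U] is spanned by coefficients
   [(e_i)_{n;k} f_j], where [n] is determined by the weight and [k] is bounded;
   the part in [C_1(U)] comes from finitely many lower weight spaces. *)
Lemma fusion_grading_restricted : grading_restricted U.
Proof.
split=> // l; apply: finspan_fin_dim; first exact: gen_eig_subspace.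
have [s1 [h1 gen1]] := C1_cofinite_hom gW1 cW1.
have [s2 [h2 gen2]] := C1_cofinite_hom gW2 cW2.
pose G m := span (io_gens s1 s2 m `|` @C1_hom _ _ _ U m).
have GE m : G m = @gen_eig _ _ _ U m.
  apply: (geig_full (@tw_L0_linear _ _ _ U) (G := G)) => [{}m|{}m|].
  - exact: span_subspace.
  - apply: span_sub; first exact: gen_eig_subspace.
    move=> x [[le1 [le2 [k [/h1 e1 /h2 e2 ->]]]]|]; last exact: C1_hom_weight.
    have := io_weight hY (le1.1 + le2.1 - m - 1) k e1 e2.
    by congr (gen_eig _ _); ring.
  apply/seteqP; split=> // x _.
  have sG : subspace (span (\bigcup_m G m)) := span_subspace _.
  have : span [set x : U | exists w1 n k w2, x = Y w1 n k w2] x by rewrite sY.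
  apply: (span_sub sG) => _ [w1 [n [k [w2 ->]]]].
  have : span (\bigcup_a @gen_eig _ _ _ W1 a) w1 by case: gW1 => -[_ ->].
  apply: (span_sub (B := (fun w => Y w n k w2) @^-1` span (\bigcup_m G m))).
    by apply: subspace_preim => //; exact: io_linearl.
  move=> {}w1 [a _ w1a].
  have : span (\bigcup_b @gen_eig _ _ _ W2 b) w2 by case: gW2 => -[_ ->].
  apply: (span_sub (B := Y w1 n k @^-1` span (\bigcup_m G m))).
    by apply: subspace_preim => //; exact: io_linearr.
  move=> {}w2 [b _ w2b]; apply: sub_span; exists (a + b - n - 1) => //.
  (* The target weight is chosen as that of the given coefficient, so that [a + b - l - 1] is its
     index [n]. *)
  have := io_generated gW1 gW2 gen1 gen2 (l := a + b - n - 1) k w1a w2b.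
  by congr (span _ (Y _ _ _ _)); ring.
have [A hA] := gU.2 l; set T := aut_order g3 in hA.
have T0 : T%:R != 0 :> R[i] := aut_order_neq0 g3 _.
(* [N] bounds the height of the weight above [A]; for [N = 0] the weight space is zero. *)
suff H : forall (N : nat) (n : int), n - A < N ->
    finspan (@gen_eig _ _ _ U (l + n%:~R / T%:R)).
  by have := H (`|0 - A|.+1)%N 0; rewrite mul0r addr0; apply; lia.
elim=> [|N IH] n nN.
  by apply: finspan_sub (finspan_null _); apply: hA; lia.
rewrite -GE; apply: finspan_span; apply: finspan_setU; first exact: finspan_io_gens.
apply: finspan_C1_hom => // j j0.
have -> : l + n%:~R / T%:R - j%:R / T%:R = l + (n - j%:Z)%:~R / T%:R.
  by rewrite intrB mulrBl addrA.
by apply: IH; lia.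
Qed.

End FusionFiniteness.

(** * Irreducible subquotients and the fusion product *)

Lemma fin_dim_inj (K : fieldType) (M N : lmodType K) (f : M -> N) (A : set M) :
  linear f -> injective f -> subspace A -> fin_dim (f @` A) -> fin_dim A.
Proof.
move=> lf fi sA [n [b [Ab bP]]]; apply: finspan_fin_dim => //.
have Ab' i : exists x, A x /\ f x = b i by have [x Ax fx] := Ab i; exists x.
have [a aP] := choice Ab'.
exists (codom a) => x Ax; have [|c [fxc _]] := bP (f x); first by exists x.
have -> : x = \sum_(i < n) c 0 i *: a i.
  apply: fi; rewrite fxc lin_sum //; apply: eq_bigr => i _.
  by rewrite linZ // (aP i).2.
apply: (subspace_sum (span_subspace _)) => i _ _.
by apply: (subspaceZ (span_subspace _)); apply: sub_span; rewrite /= codom_f.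
Qed.

Section Homomorphisms.
Variables (R : realType) (V : voa R) (g : fin_aut V).

Lemma tw_hom_L0 (M N : twisted_module g) (f : M -> N) : tw_hom f ->
  forall x, f (tw_L 0 x) = tw_L 0 (f x).
Proof. by move=> [_ fm] x; apply: fm. Qed.

Lemma tw_hom_comp (M N L : twisted_module g) (f : M -> N) (h : N -> L) :
  tw_hom f -> tw_hom h -> tw_hom (h \o f).
Proof.
move=> [lf fm] [lh hm]; split=> [a x y|v n w] /=; first by rewrite lf lh.
by rewrite fm hm.
Qed.

Lemma generalizedP (M : twisted_module g) : generalized M <->
  span (\bigcup_l @gen_eig _ _ _ M l) = [set: M] /\
  forall l : R[i], exists N : int, forall n : int, n < N ->
    @gen_eig _ _ _ M (l + n%:~R / (aut_order g)%:R) `<=` [set 0].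
Proof.
by split=> -[sp low]; split=> //; [case: sp|apply/geig_direct_sum => //; exact: tw_L0_linear].
Qed.

Lemma tw_hom_im (M N : twisted_module g) (f : M -> N) (S : set M) :
  tw_hom f -> tw_submodule S -> tw_submodule (f @` S).
Proof.
move=> [lf fm] [sS Sm]; split; first exact: subspace_im.
by move=> v n _ [x Sx <-]; exists (tw_mode v n x); [exact: Sm|exact: fm].
Qed.

Lemma tw_hom_preim (M N : twisted_module g) (f : M -> N) (S : set N) :
  tw_hom f -> tw_submodule S -> tw_submodule (f @^-1` S).
Proof.
move=> [lf fm] [sS Sm]; split; first exact: subspace_preim.
by move=> v n x /= Sx; rewrite fm; exact: Sm.
Qed.

Lemma tw_submodule0 (M : twisted_module g) : tw_submodule [set (0 : M)].
Proof. by split; [exact: subspace_null|move=> v n _ ->; exact: tw_mode0]. Qed.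

Lemma tw_kernel (M N : twisted_module g) (f : M -> N) : tw_hom f ->
  tw_submodule [set x | f x = 0].
Proof. by move=> hf; apply: (tw_hom_preim (S := [set 0]) hf); exact: tw_submodule0. Qed.

Section Embedding.
Variables (M N : twisted_module g) (f : M -> N).
Hypotheses (hf : tw_hom f) (fi : injective f).

Lemma gen_eig_hom l x : gen_eig l x -> gen_eig l (f x).
Proof. by move=> xl; exact: (geig_map hf.1 (tw_hom_L0 hf) xl). Qed.

Lemma generalized_inj : generalized N -> generalized M.
Proof.
move=> /generalizedP[sp low]; apply/generalizedP; split.
  exact: (geig_span_inj (@tw_L0_linear _ _ _ N) hf.1 (tw_hom_L0 hf) fi).
move=> l; have [A hA] := low l; exists A => n nA x /gen_eig_hom /(hA n nA) fx.
by apply: fi; rewrite [LHS]fx (lin0 hf.1).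
Qed.

Lemma grading_restricted_inj : grading_restricted N -> grading_restricted M.
Proof.
move=> [gN fN]; split=> [|l]; first exact: generalized_inj.
apply: (fin_dim_inj hf.1 fi (gen_eig_subspace _ l)).
apply: finspan_fin_dim; first exact: subspace_im hf.1 (gen_eig_subspace _ l).
apply: finspan_sub (fin_dim_finspan (fN l)) => _ [x xl <-]; exact: gen_eig_hom.
Qed.

End Embedding.

Section Surjection.
Variables (M N : twisted_module g) (f : M -> N).
Hypotheses (hf : tw_hom f) (fs : f @` [set: M] = [set: N]).

Lemma gen_eig_surj l : generalized M -> f @` @gen_eig _ _ _ M l = @gen_eig _ _ _ N l.
Proof.
move=> /generalizedP[sp _].
exact: (geig_im_surj (@tw_L0_linear _ _ _ M) (@tw_L0_linear _ _ _ N) hf.1 (tw_hom_L0 hf)).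
Qed.

Lemma grading_restricted_surj : grading_restricted M -> grading_restricted N.
Proof.
move=> [gM fM]; have /generalizedP[sp low] := gM; split.
  apply/generalizedP; split.
    exact: (geig_span_surj hf.1 (tw_hom_L0 hf)).
  move=> l; have [A hA] := low l; exists A => n nA y.
  by rewrite -gen_eig_surj // => -[x /(hA n nA) -> <-]; exact: (lin0 hf.1).
move=> l; have := fin_dim_im hf.1 (gen_eig_subspace _ l) (gen_eig_surj l gM) (fM l).
exact.
Qed.

End Surjection.

Lemma max_submodule_avoiding (M : twisted_module g) (w : M) : w != 0 ->
  exists N : set M, [/\ tw_submodule N, ~ N w &
    forall S, tw_submodule S -> N `<=` S -> ~ S w -> S `<=` N].
Proof.
move=> w0.
(* Membership of zero is left out so that the union of the empty chain satisfies [Q]. *)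
pose Q (N : set M) := [/\ forall (a : R[i]) x y, N x -> N y -> N (a *: x + y),
  forall v n x, N x -> N (tw_mode v n x) & ~ N w].
have Qsub S : tw_submodule S -> ~ S w -> Q S by move=> [[_ lS] Sm] Sw.
have [F FQ Ftot|N [[Nl Nm Nw] Nmax]] := @Zorn_bigcup M Q.
  split.
  - move=> a x y [A FA Ax] [B FB By]; have [AB|BA] := Ftot _ _ FA FB.
      by exists B => //; have [h _ _] := FQ _ FB; apply: h => //; exact: AB.
    by exists A => //; have [h _ _] := FQ _ FA; apply: h => //; exact: BA.
  - by move=> v n x [A FA Ax]; exists A => //; have [_ h _] := FQ _ FA; apply: h.
  - by move=> [A FA]; have [_ _] := FQ _ FA.
(* A set satisfying [Q] without zero is empty, and then the zero submodule, which avoids [w], would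
   be strictly larger. *)
have N0 : N 0.
  apply: contrapT => nN0; apply: (Nmax [set 0]); last first.
    by apply: Qsub (tw_submodule0 _) _ => /= /eqP; rewrite (negbTE w0).
  split=> [x Nx|]; last by move=> /(_ 0 erefl).
  by case: nN0; rewrite -(addNr x) -scaleN1r; apply: Nl.
exists N; split=> // S sS NS Sw; apply: contrapT => nSN.
by apply: (Nmax S); [split|exact: Qsub].
Qed.

(* If [N] is maximal among the submodules avoiding [w], every nonzero submodule of
   the quotient by [N] contains the image of [w], so the submodule generated by
   that image is irreducible. *)
Lemma irreducible_subquotient (M : twisted_module g) (w : M) : w != 0 ->
  exists (Q X : twisted_module g) (f : M -> Q) (i : X -> Q),
    [/\ tw_hom f, f @` [set: M] = [set: Q], tw_hom i, injective i & irreducible X].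
Proof.
move=> w0; have [N [sN Nw Nmax]] := max_submodule_avoiding w0.
have [Q [f [hf fs fN]]] := tw_quot sN.
pose I := [set x : Q | forall S, tw_submodule S -> S (f w) -> S x].
have sI : tw_submodule I.
  split; first split.
  - by move=> S [sS _] _; exact: subspace0.
  - by move=> a x y Ix Iy S sS Sw; apply: (proj2 sS.1); [exact: Ix|exact: Iy].
  - by move=> v n x Ix S sS Sw; apply: sS.2; exact: Ix.
have [X [i [hi ii iI]]] := tw_sub sI.
exists Q, X, f, i; split=> //.
  by apply/seteqP; split=> // y _; have [x <-] := fs y; exists x.
have fw0 : f w <> 0 by move=> /fN.
split.
  have [x xw] : exists x, i x = f w by apply/iI => S _.
  by exists x; apply/eqP => x0; apply: fw0; rewrite -xw x0 (lin0 hi.1).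
move=> T sT; have siT := tw_hom_im hi sT.
have [Tw|Tw] := pselect ((i @` T) (f w)).
  right; apply/seteqP; split=> // x _.
  have Ix : I (i x) by apply/iI; exists x.
  by have [y Ty /ii <-] := Ix _ siT Tw.
left; apply/seteqP; split=> [x Tx|_ ->]; last by case: sT => sT _; exact: subspace0.
have [z zx] := fs (i x).
(* The preimage in [M] of a submodule missing [f w] contains [N] and avoids [w], so maximality puts
   it inside [N]. *)
have : N z.
  apply: (Nmax (f @^-1` (i @` T))) => //; first exact: tw_hom_preim.
  - by move=> y /fN; rewrite /preimage /= => ->; exists 0; [exact: subspace0 sT.1|exact: lin0 hi.1].
  - by rewrite /preimage /= zx; exists x.
by move=> /fN; rewrite zx => ix; apply: ii; rewrite ix (lin0 hi.1).
Qed.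

Lemma nonzero_at_conformal_weight (p : nat) (S : 'I_p -> twisted_module g)
    (u : 'I_p -> R[i]) (M : twisted_module g) (w : M) :
  complete_irreducibles S -> (forall i, conformal_weight (S i) (u i)) ->
  grading_restricted M -> w != 0 ->
  exists (i : 'I_p) (x : M), x != 0 /\ gen_eig (u i) x.
Proof.
move=> [_ _ Sall] Su gM w0.
have [Q [X [f [i [hf fs hi ii irrX]]]]] := irreducible_subquotient w0.
have gX := grading_restricted_inj hi ii (grading_restricted_surj hf fs gM).
have [j [h hh bh]] := Sall X irrX gX.
have [_ [y yu y0]] := Su j.
(* The vector of weight [u j] travels from [S j] through [X] into the quotient [Q], and lifts to [M]
   because weight spaces map onto weight spaces. *)
have := gen_eig_hom hi (gen_eig_hom hh yu); rewrite -(gen_eig_surj hf fs _ gM.1).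
move=> [x xu fx]; exists j, x; split=> //; apply/eqP => x0.
move/eqP: y0; apply; apply: (bij_inj bh); apply: ii.
by rewrite -fx x0 (lin0 hf.1) (lin0 hh.1) (lin0 hi.1).
Qed.

(** Surjectivity bounds every summand of [dim_at u P] by that of [dim_at u U], so the opposite
    inequality of sums forces equality termwise and [f] is injective at each weight [u i]. The
    kernel, itself grading restricted, then has nothing at these weights. *)
Lemma injective_of_dim_at (p : nat) (S : 'I_p -> twisted_module g)
    (u : 'I_p -> R[i]) (U P : twisted_module g) (f : U -> P) :
  complete_irreducibles S -> (forall i, conformal_weight (S i) (u i)) ->
  grading_restricted U -> tw_hom f -> f @` [set: U] = [set: P] ->
  (dim_at u U <= dim_at u P)%N -> injective f.
Proof.
move=> Sc Su gU hf fs dUP.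
have le i := vs_dim_surj hf.1 (gen_eig_subspace _ (u i)) (gen_eig_subspace _ (u i))
  (gen_eig_surj hf fs (u i) gU.1) (gU.2 (u i)).
have eq i : vs_dim (@gen_eig _ _ _ P (u i)) = vs_dim (@gen_eig _ _ _ U (u i)).
  apply/eqP; rewrite eqn_leq le /= leqNgt; apply/negP => lt.
  move: dUP; rewrite /dim_at leqNgt => /negP; apply.
  rewrite [X in (X < _)%N](bigD1 i) // [X in (_ < X)%N](bigD1 i) //= -addSn.
  by apply: leq_add lt _; apply: leq_sum => j _; exact: le.
apply: (inj_lin hf.1) => x fx; apply/eqP; apply: contraT => x0.
have [K [k [hk ki kP]]] := tw_sub (tw_kernel hf).
have [y yx] : exists y, k y = x by apply/kP.
have y0 : y != 0 by apply: contra_neq x0 => y0; rewrite -yx y0 (lin0 hk.1).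
have [i [z [z0 zu]]] := nonzero_at_conformal_weight Sc Su (grading_restricted_inj hk ki gU) y0.
have : k z = 0.
  apply: (vs_dim_surj_inj hf.1 (gen_eig_subspace _ (u i)) (gen_eig_subspace _ (u i))
    (gen_eig_surj hf fs (u i) gU.1) (gU.2 (u i)) (eq i)); first exact: gen_eig_hom.
  by apply/kP; exists z.
by move=> kz; case/eqP: z0; apply: ki; rewrite kz (lin0 hk.1).
Qed.

Lemma tw_prod (P W : twisted_module g) : exists (D : twisted_module g) (f1 : D -> P) (f2 : D -> W),
  [/\ tw_hom f1, tw_hom f2, forall x y, exists z, f1 z = x /\ f2 z = y
    & forall x y, f1 x = f1 y -> f2 x = f2 y -> x = y].
Proof.
have [|D [f1 [f2 [h1 h2 DP f12]]]] := @tw_sub_prod _ _ _ P W setT _ (fun _ _ _ _ => I).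
  by [].
exists D, f1, f2; split=> // x y.
by have [z [<- <-]] := (DP (x, y)).1 I; exists z.
Qed.

Lemma generalized_prod (P W D : twisted_module g) (f1 : D -> P) (f2 : D -> W) :
  tw_hom f1 -> tw_hom f2 -> (forall x y, exists z, f1 z = x /\ f2 z = y) ->
  (forall x y, f1 x = f1 y -> f2 x = f2 y -> x = y) ->
  generalized P -> generalized W -> generalized D.
Proof.
move=> h1 h2 fs f12 /generalizedP[spP lowP] /generalizedP[spW lowW].
have fs' (xy : P * W) : exists z, f1 z = xy.1 /\ f2 z = xy.2 by exact: fs.
have [j jP] := choice fs'.
have j1 xy : f1 (j xy) = xy.1 := (jP xy).1.
have j2 xy : f2 (j xy) = xy.2 := (jP xy).2.
(* As [j] inverts the pair of projections, this is the inclusion of the first summand, and [hj2]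
   concerns the second. They carry weight vectors of [P] and [W] into [D]. *)
have hj1 : tw_hom (fun x => j (x, 0)).
  split=> [a x y|v n x]; apply: f12; rewrite ?h1.1 ?h2.1 ?h1.2 ?h2.2 ?j1 ?j2 //=.
  - by rewrite scaler0 addr0.
  - by rewrite tw_mode0.
have hj2 : tw_hom (fun y => j (0, y)).
  split=> [a x y|v n x]; apply: f12; rewrite ?h1.1 ?h2.1 ?h1.2 ?h2.2 ?j1 ?j2 //=.
  - by rewrite scaler0 addr0.
  - by rewrite tw_mode0.
apply/generalizedP; split.
  apply/seteqP; split=> // z _.
  have -> : z = j (f1 z, 0) + j (0, f2 z).
    by apply: f12; rewrite ?(linD h1.1) ?(linD h2.1) ?j1 ?j2 /= ?addr0 ?add0r.
  have sD : subspace (span (\bigcup_l @gen_eig _ _ _ D l)) := span_subspace _.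
  apply: (subspaceD sD).
    have : span (\bigcup_l @gen_eig _ _ _ P l) (f1 z) by rewrite spP.
    apply: (span_sub (subspace_preim hj1.1 sD)) => x [l _ xl].
    by apply: sub_span; exists l => //; exact: (gen_eig_hom hj1).
  have : span (\bigcup_l @gen_eig _ _ _ W l) (f2 z) by rewrite spW.
  apply: (span_sub (subspace_preim hj2.1 sD)) => x [l _ xl].
  by apply: sub_span; exists l => //; exact: (gen_eig_hom hj2).
move=> l; have [A hA] := lowP l; have [B hB] := lowW l.
exists (Num.min A B) => n; rewrite lt_min => /andP[nA nB] z zl.
apply: f12.
  by rewrite [LHS](hA n nA _ (gen_eig_hom h1 zl)) (lin0 h1.1).
by rewrite [LHS](hB n nB _ (gen_eig_hom h2 zl)) (lin0 h2.1).
Qed.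

End Homomorphisms.

Section FusionProduct.
Variables (R : realType) (V : voa R) (g1 g2 g3 : fin_aut V).
Hypothesis g12 : forall v, g1 (g2 v) = g2 (g1 v).
Hypothesis g3E : forall v, g3 v = g1 (g2 v).
Variables (W1 : twisted_module g1) (W2 : twisted_module g2).

(** The axioms come from [intertwining_embed] with both maps equal to [i]; surjectivity holds
    because [i] maps onto nothing more than the span of the coefficients. *)
Lemma intertwining_corestrict (U D : twisted_module g3) (i : U -> D)
    (Y : W1 -> R[i] -> nat -> W2 -> D) :
  tw_hom i -> injective i -> intertwining Y ->
  (forall x, io_image Y x <-> exists y, i y = x) ->
  exists Y' : W1 -> R[i] -> nat -> W2 -> U,
    [/\ intertwining Y', surjective_io Y' & forall w1 n k w2, i (Y' w1 n k w2) = Y w1 n k w2].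
Proof.
move=> hi ii hY iP.
pose Y' w1 n k w2 := xget 0 [set y | i y = Y w1 n k w2].
have Y'E w1 n k w2 : i (Y' w1 n k w2) = Y w1 n k w2.
  rewrite /Y'; case: xgetP => [y _ //|].
  have /iP[y yE] : io_image Y (Y w1 n k w2) by apply: sub_span; exists w1, n, k, w2.
  by move=> /(_ y).
exists Y'; split=> //.
  by apply: (intertwining_embed hY hY hi hi) => // x y xy _; exact: ii.
apply/seteqP; split=> // x _.
have : io_image Y (i x) by apply/iP; exists x.
have sI := subspace_im hi.1 (span_subspace [set x | exists w1 n k w2, x = Y' w1 n k w2]).
move=> /(span_sub sI)[_ [w1 [n [k [w2 ->]]]]|y yI /ii <- //].
by exists (Y' w1 n k w2) => //; apply: sub_span; exists w1, n, k, w2.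
Qed.

Lemma tw_hom_io_surj (U P : twisted_module g3) (f : U -> P)
    (Y : W1 -> R[i] -> nat -> W2 -> U) (YP : W1 -> R[i] -> nat -> W2 -> P) :
  tw_hom f -> (forall w1 n k w2, f (Y w1 n k w2) = YP w1 n k w2) ->
  surjective_io YP -> f @` [set: U] = [set: P].
Proof.
move=> hf fY sYP; apply/seteqP; split=> // y _.
have : span [set x | exists w1 n k w2, x = YP w1 n k w2] y by rewrite sYP.
apply: span_sub; first exact: subspace_im hf.1 _.
by move=> _ [w1 [n [k [w2 ->]]]]; exists (Y w1 n k w2).
Qed.

Lemma tw_hom_io_unique (P W : twisted_module g3) (YP : W1 -> R[i] -> nat -> W2 -> P)
    (f h : P -> W) :
  surjective_io YP -> tw_hom f -> tw_hom h ->
  (forall w1 n k w2, f (YP w1 n k w2) = h (YP w1 n k w2)) -> f = h.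
Proof.
move=> sYP hf hh fh; apply/funext => x.
have : span [set x | exists w1 n k w2, x = YP w1 n k w2] x by rewrite sYP.
apply: (span_sub (B := [set x | f x = h x])) => [|_ [w1 [n [k [w2 ->]]]] //].
split; first by rewrite /= (lin0 hf.1) (lin0 hh.1).
by move=> a y z /= yE zE; rewrite hf.1 hh.1 yE zE.
Qed.

End FusionProduct.

(** * The universal property *)

Theorem theorem3 (R : realType) (V : voa R) (g1 g2 g3 : fin_aut V)
    (W1 : twisted_module g1) (W2 : twisted_module g2)
    (p : nat) (S : 'I_p -> twisted_module g3) (u : 'I_p -> complex R)
    (P : twisted_module g3) (YP : W1 -> complex R -> nat -> W2 -> P) :
  C2_cofinite V ->
  (forall v, g1 (g2 v) = g2 (g1 v)) ->
  (forall v, g3 v = g1 (g2 v)) ->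
  generalized W1 -> C1_cofinite W1 ->
  generalized W2 -> C1_cofinite W2 ->
  complete_irreducibles S ->
  (forall i, conformal_weight (S i) (u i)) ->
  in_F YP ->
  (forall (U : twisted_module g3) (Y : W1 -> complex R -> nat -> W2 -> U),
     in_F Y -> (dim_at u U <= dim_at u P)%N) ->
  fusion_product YP.
Proof.
move=> _ g12 g3E gW1 cW1 gW2 cW2 Sc Su [gP hP sP] Pmax.
split=> // W Y gW hY.
have [D [f1 [f2 [hf1 hf2 fs f12]]]] := tw_prod P W.
pose YD w1 n k w2 := xget 0 [set z | f1 z = YP w1 n k w2 /\ f2 z = Y w1 n k w2].
have YDE w1 n k w2 : f1 (YD w1 n k w2) = YP w1 n k w2 /\ f2 (YD w1 n k w2) = Y w1 n k w2.
  rewrite /YD; case: xgetP => [z _ //|].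
  by have [z zE] := fs (YP w1 n k w2) (Y w1 n k w2); move=> /(_ z).
have hD : intertwining YD.
  apply: (intertwining_embed hP hY hf1 hf2 f12) => w1 n k w2.
    exact: (YDE w1 n k w2).1.
  exact: (YDE w1 n k w2).2.
have [U [i [hi ii iP]]] := tw_sub (io_image_submodule g12 g3E hD).
have [YU [hU sU YUE]] := intertwining_corestrict hi ii hD iP.
have gU : generalized U.
  exact: generalized_inj hi ii (generalized_prod hf1 hf2 fs f12 gP gW).
have hp := tw_hom_comp hi hf1; have hq := tw_hom_comp hi hf2.
have pY w1 n k w2 : (f1 \o i) (YU w1 n k w2) = YP w1 n k w2.
  by rewrite /= YUE (YDE w1 n k w2).1.
have qY w1 n k w2 : (f2 \o i) (YU w1 n k w2) = Y w1 n k w2.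
  by rewrite /= YUE (YDE w1 n k w2).2.
have ps := tw_hom_io_surj hp pY sP.
(* Finite dimensionality has to precede the comparison of dimensions: [vs_dim] is 0 on an
   infinite-dimensional space, so the bound on [dim_at u U] alone would say little. *)
have rU : grading_restricted U.
  exact: (fusion_grading_restricted g12 g3E hU gW1 cW1 gW2 cW2 gU sU).
have dU : (dim_at u U <= dim_at u P)%N by apply: (Pmax U YU).
have pinj := injective_of_dim_at Sc Su rU hp ps dU.
have ps' x : exists y, (f1 \o i) y = x.
  have : ((f1 \o i) @` setT) x by rewrite ps.
  by move=> [y _ yx]; exists y.
(* The projection is bijective, so this chosen section is its inverse and hence a homomorphism. *)
have [h hK] := choice ps'.
have hh : tw_hom h.
  split=> [a x y|v n x]; apply: pinj; rewrite ?hp.1 ?hp.2 !hK //.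
exists ((f2 \o i) \o h); split=> [|f [hf fY]].
  split=> [|w1 n k w2]; first exact: tw_hom_comp hh hq.
  rewrite -qY [RHS]/((f2 \o i) _); congr ((f2 \o i) _).
  by apply: pinj; rewrite hK pY.
apply: (tw_hom_io_unique sP (tw_hom_comp hh hq) hf) => w1 n k w2.
rewrite -fY -qY [LHS]/((f2 \o i) _); congr ((f2 \o i) _).
by apply: pinj; rewrite hK pY.
Qed.
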